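(* Let $D\ge5$, $n\ge1$, and let $\mathcal{Z}$ be a quasi-topological density of curvature order $n$ in $D$ dimensions. Then there is a constant $c$ such that $$\mathcal{Z}|_f=\frac{c}{r^{D-2}}\frac{d}{dr}\Big\{r^{D-1}\big[(2n-D)\,\psi^n-2n\,\psi^{n-1}\mathcal{B}\big]\Big\},$$ and its contribution to the integrated equation of motion for $f$ is a constant multiple of $(D-2n)\,r^{D-2n-1}(k-f)^n$. Thus, up to normalization, there is a unique possible on-shell form of a quasi-topological density at each order.
   Context: An order-$n$ density is a linear combination of complete contractions of $n$ Riemann tensors with metrics. $\mathcal{Z}|_f$ denotes evaluation on $ds^2=-f(r)dt^2+dr^2/f(r)+r^2d\Sigma_k^2$, where $d\Sigma^2_k$ is the metric of the $(D-2)$-dimensional unit sphere, flat space or unit hyperbolic space for $k=1,0,-1$, and $f$ is arbitrary. Define $\mathcal{B}=-\frac{f'}{2r}$, $\psi=\frac{k-f}{r^2}$. A density is generalized quasi-topological (GQT) if $r^{D-2}\mathcal{Z}|_f$ is a total derivative, i.e. its Euler–Lagrange expression with respect to $f$ vanishes identically; it is quasi-topological (QT) if in addition $$\Big[\tfrac{D-2}{r}\tfrac{\partial}{\partial f''}+\tfrac{d}{dr}\tfrac{\partial}{\partial f''}+\tfrac{D-3}{2}\tfrac{\partial}{\partial f'}+\tfrac r2\tfrac{d}{dr}\tfrac{\partial}{\partial f'}-r\tfrac{\partial}{\partial f}\Big]\mathcal{Z}|_f=0 .$$ Integrated equation: evaluating on $ds^2=-N^2f\,dt^2+dr^2/f+r^2d\Sigma_k^2$,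 a GQT density gives $Nr^{D-2}\mathcal{Z}|_{N,f}=NT_0'+N'T_1+N''T_2+O(N'^2/N)$ with $T_i$ functions of $r$, $f$ and derivatives of $f$, and the contribution to the integrated equation for $f$ is $T_0-T_1+T_2'$ (where $T_0=r^{D-1}\sum_j\alpha_j\psi^{n-j}\mathcal{B}^j$ when $r^{D-2}\mathcal{Z}|_f=\frac{d}{dr}[r^{D-1}\sum_j\alpha_j\psi^{n-j}\mathcal{B}^j]$). *)

(* Defs.v *)
From HB Require Import structures.
From mathcomp Require Import all_boot all_order all_algebra all_fingroup.
From mathcomp Require Import all_classical all_reals all_analysis.
Set Implicit Arguments.
Unset Strict Implicit.
Unset Printing Implicit Defensive.
Import Order.TTheory GRing.Theory Num.Theory.
Import numFieldNormedType.Exports.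
Local Open Scope classical_set_scope.
Local Open Scope ring_scope.

(* In ring_scope these notations otherwise denote derivatives of polynomials. *)
Local Notation "f ^` ()" := (derive1 f) : ring_scope.
Local Notation "f ^` ( n )" := (derive1n n f) : ring_scope.

(* Points of a coordinate chart are row vectors; a metric is a matrix field. *)

Definition pderiv (R : realType) (D : nat) (i : 'I_D) (F : 'rV[R]_D -> R)
  (x : 'rV[R]_D) : R := 'D_(delta_mx 0 i) F x.

Definition christoffel (R : realType) (D : nat) (g : 'rV[R]_D -> 'M[R]_D)
  (a b c : 'I_D) (x : 'rV[R]_D) : R :=
  2^-1 * \sum_(e < D) invmx (g x) a e *
    (pderiv b (fun y => g y e c) x + pderiv c (fun y => g y e b) x
     - pderiv e (fun y => g y b c) x).

(* R^a_{bcd}, with the sign for which the unit sphere has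
   R_{abcd} = g_ac g_bd - g_ad g_bc. *)
Definition riemann_up (R : realType) (D : nat) (g : 'rV[R]_D -> 'M[R]_D)
  (a b c d : 'I_D) (x : 'rV[R]_D) : R :=
  pderiv c (christoffel g a d b) x - pderiv d (christoffel g a c b) x
  + \sum_(e < D) (christoffel g a c e x * christoffel g e d b x
                  - christoffel g a d e x * christoffel g e c b x).

Definition riemann (R : realType) (D : nat) (g : 'rV[R]_D -> 'M[R]_D)
  (a b c d : 'I_D) (x : 'rV[R]_D) : R :=
  \sum_(e < D) g x a e * riemann_up g e b c d x.

(* The 4n index slots of a product of n Riemann tensors: (m, p, q) is entry q
   of the antisymmetric pair p of the m-th factor. *)
Definition slot (n : nat) : finType := ('I_n * bool * bool)%type.

(* The 2n inverse metrics are labelled by (m, p); the one labelled (m, p) joins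
   the slots s (m, p, false) and s (m, p, true).  Every complete contraction
   arises from some permutation s of the slots. *)
Definition complete_contraction (R : realType) (D n : nat)
  (g : 'rV[R]_D -> 'M[R]_D) (s : {perm slot n}) (x : 'rV[R]_D) : R :=
  \sum_(i : {ffun slot n -> 'I_D})
    (\prod_(m < n) riemann g (i (m, false, false)) (i (m, false, true))
                             (i (m, true, false)) (i (m, true, true)) x)
    * (\prod_(mp : 'I_n * bool)
         invmx (g x) (i (s (mp, false))) (i (s (mp, true)))).

(* A density of order n: the coefficients of a linear combination of complete
   contractions. *)
Definition density (R : realType) (n : nat) := {perm slot n} -> R.

Definition eval_density (R : realType) (D n : nat) (Z : density R n)
  (g : 'rV[R]_D -> 'M[R]_D) (x : 'rV[R]_D) : R :=
  \sum_(s : {perm slot n}) Z s * complete_contraction g s x.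

(* Coordinates (t, r, y_2, ..., y_{D-1}).  The default 0 is only reached when
   D <= 1. *)
Definition radial_coord (R : realType) (D : nat) (x : 'rV[R]_D) : R :=
  oapp (fun i : 'I_D => x 0 i) 0 (insub 1%N).

(* In the coordinates y, dSigma_k^2 = dy^2 / (1 + k |y|^2 / 4)^2
   (stereographic chart, flat space, Poincare ball for k = 1, 0, -1). *)
Definition horizon_factor (R : realType) (D : nat) (k : R) (x : 'rV[R]_D) : R :=
  1 + k / 4 * \sum_(i < D | (2 <= i)%N) x 0 i ^+ 2.

(* ds^2 = - N^2 f dt^2 + dr^2 / f + r^2 dSigma_k^2 *)
Definition static_metric (R : realType) (D : nat) (k : R) (N f : R -> R)
  (x : 'rV[R]_D) : 'M[R]_D :=
  let r := radial_coord x in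
  \matrix_(i, j)
    if i != j then 0
    else match nat_of_ord i with
         | 0 => - N r ^+ 2 * f r
         | 1 => (f r)^-1
         | _ => r ^+ 2 / horizon_factor k x ^+ 2
         end.

Definition horizon_curvature (R : realType) (k : R) : Prop :=
  [\/ k = 1, k = 0 | k = -1].

Definition smooth_near (R : realType) (f : R -> R) (r : R) : Prop :=
  \forall s \near r, forall m : nat, derivable (f^`(m)) s 1.

(* f is an otherwise arbitrary smooth function, nonzero where the metric is
   evaluated. *)
Definition regular_at (R : realType) (f : R -> R) (r : R) : Prop :=
  [/\ 0 < r, smooth_near f r & f r != 0].

Definition in_chart (R : realType) (D : nat) (k : R) (x : 'rV[R]_D) : Prop :=
  0 < radial_coord x /\ 0 < horizon_factor k x.

(* Z|_{N,f} and Z|_f as scalar fields on the chart. *)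
Definition on_shell_N (R : realType) (D n : nat) (k : R) (Z : density R n)
  (N f : R -> R) (x : 'rV[R]_D) : R :=
  eval_density Z (static_metric k N f) x.

Definition on_shell (R : realType) (D n : nat) (k : R) (Z : density R n)
  (f : R -> R) (x : 'rV[R]_D) : R := on_shell_N k Z (fun=> 1) f x.

(* Since Sigma_k is homogeneous, scalars depend on r only; as functions of r
   they are read off on the line t = 0, y = 0. *)
Definition on_axis (R : realType) (D : nat) (r : R) : 'rV[R]_D :=
  \row_(i < D) if (i : nat) == 1%N then r else 0.

Definition radial_on_shell_N (R : realType) (D n : nat) (k : R)
  (Z : density R n) (N f : R -> R) (r : R) : R :=
  on_shell_N k Z N f (on_axis D r).

(* Functions of r, f, f', f'' regarded as four independent variables. *)
Definition jet_function (R : realType) := R -> R -> R -> R -> R.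

(* Z|_f involves no derivative of f beyond f'', so its value at r as a function
   of (r, f, f', f'') is obtained from the quadratic f with these data at r. *)
Definition on_shell_jet (R : realType) (D n : nat) (k : R) (Z : density R n) :
  jet_function R :=
  fun r a b c =>
    radial_on_shell_N D k Z (fun=> 1)
      (fun s => a + b * (s - r) + c / 2 * (s - r) ^+ 2) r.

Definition jet_d0 (R : realType) (L : jet_function R) : jet_function R :=
  fun r a b c => (fun a' => L r a' b c)^`() a.
Definition jet_d1 (R : realType) (L : jet_function R) : jet_function R :=
  fun r a b c => (fun b' => L r a b' c)^`() b.
Definition jet_d2 (R : realType) (L : jet_function R) : jet_function R :=
  fun r a b c => (fun c' => L r a b c')^`() c.

Definition along (R : realType) (L : jet_function R) (f : R -> R) (r : R) : R :=
  L r (f r) (f^`() r) (f^`(2) r).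

Definition euler_lagrange (R : realType) (L : jet_function R) (f : R -> R)
  (r : R) : R :=
  along (jet_d0 L) f r - (along (jet_d1 L) f)^`() r
  + (along (jet_d2 L) f)^`(2) r.

Definition generalized_quasi_topological (R : realType) (D n : nat) (k : R)
  (Z : density R n) : Prop :=
  forall f r, regular_at f r ->
    euler_lagrange (fun r a b c => r ^+ (D - 2) * on_shell_jet D k Z r a b c)
      f r = 0.

Definition quasi_topological (R : realType) (D n : nat) (k : R)
  (Z : density R n) : Prop :=
  generalized_quasi_topological D k Z /\
  forall f r, regular_at f r ->
    let L := on_shell_jet D k Z in
    (D%:R - 2) / r * along (jet_d2 L) f r
    + (along (jet_d2 L) f)^`() r
    + (D%:R - 3) / 2 * along (jet_d1 L) f r
    + r / 2 * (along (jet_d1 L) f)^`() r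
    - r * along (jet_d0 L) f r = 0.

Definition calB (R : realType) (f : R -> R) (r : R) : R := - f^`() r / (2 * r).

Definition psi (R : realType) (k : R) (f : R -> R) (r : R) : R :=
  (k - f r) / r ^+ 2.

Definition T0_of (R : realType) (D n : nat) (k : R) (alpha : 'I_n.+1 -> R)
  (f : R -> R) (r : R) : R :=
  r ^+ (D - 1) * \sum_(j < n.+1) alpha j * psi k f r ^+ (n - j) * calB f r ^+ j.

(* N r^{D-2} Z|_{N,f} = N T0' + N' T1 + N'' T2 + O(N'^2/N), where the remainder
   collects all the terms at least quadratic in (N', N'').  For each f the T_i
   are functions of r.  At N = 1 this says r^{D-2} Z|_f = T0'. *)
Definition N_expansion (R : realType) (D n : nat) (k : R) (Z : density R n)
  (T0 T1 T2 : (R -> R) -> R -> R) : Prop :=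
  forall f r, regular_at f r ->
  exists C delta : R, 0 < delta /\
  forall N : R -> R, smooth_near N r -> 0 < N r ->
    `|N^`() r| <= delta * N r -> `|N^`(2) r| <= delta * N r ->
    `|N r * r ^+ (D - 2) * radial_on_shell_N D k Z N f r
      - (N r * (T0 f)^`() r + N^`() r * T1 f r + N^`(2) r * T2 f r)|
    <= C * ((N^`() r ^+ 2 + N^`(2) r ^+ 2) / N r).

(* E is the contribution of Z to the integrated equation of motion for f. *)
Definition integrated_equation (R : realType) (D n : nat) (k : R)
  (Z : density R n) (E : (R -> R) -> R -> R) : Prop :=
  exists (alpha : 'I_n.+1 -> R) (T1 T2 : (R -> R) -> R -> R),
    N_expansion D k Z (T0_of D k alpha) T1 T2 /\
    forall f r, regular_at f r ->
      E f r = T0_of D k alpha f r - T1 f r + (T2 f)^`() r.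

(* Main.v *)
Require Import Defs.
From HB Require Import structures.
From mathcomp Require Import all_boot all_order all_algebra all_fingroup.
From mathcomp Require Import all_classical all_reals all_analysis.
From mathcomp Require Import zify ring lra.
Set Implicit Arguments.
Unset Strict Implicit.
Unset Printing Implicit Defensive.
Import Order.TTheory GRing.Theory Num.Theory.
Import numFieldNormedType.Exports.
Local Open Scope classical_set_scope.
Local Open Scope ring_scope.

(** The Riemann tensor of the static metric is
    R_abcd = K_ab g_a g_b (d_ac d_bd - d_ad d_bc), where K_ab takes only four values
    A, B_t, B_r, psi, according to whether {a, b} is {t, r}, {t, y}, {r, y} or {y, y'}.
    Hence Z|_{N,f} = P(A, B_t, B_r, psi) for a homogeneous polynomial P of degree n that
    depends on neither k, f nor N and is symmetric in B_t and B_r; for N = 1 it is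
    Q(A, B, psi) = P(A, B, B, psi) with A = - f''/2.  Since r psi' = 2 (B - psi) and
    r B' = A - B, the fourth derivative of f in the Euler-Lagrange expression gives
    Q_AA = 0, the third derivative in the quasi-topological condition gives Q_AB = 0,
    and what remains of that condition is an ordinary differential equation in B that
    leaves a one-parameter family (for n = 1 one needs once more the Euler-Lagrange
    equation, at constant psi).  By homogeneity everything can be read off at r = 2,
    psi = 1.  The first-order expansion of P in N'/N and N''/N then gives T_1 and T_2,
    with P_{B_t} = Q_B / 2 by symmetry. *)

(** * Directional derivatives and curvature polynomials *)

(** Three points shape the rest. P is determined by D, n and Z alone, so a constant found with one
    horizon curvature k serves for all three. Restricting to psi = 1 and rescaling reaches every
    nonzero psi but not psi = 0, which is added by continuity. Finally, the integrated equation is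
    claimed for every admissible choice of alpha, T_1 and T_2, so exhibiting one choice is not
    enough: the expansion in N has to be unique. Testing it on N with small N' and N'' determines
    T_1, T_2 and the derivative T_0'. T_0 itself follows because r^(D-1) times a nonzero homogeneous
    polynomial in psi and B cannot have zero derivative for every f. *)

Section DirectionalDerivatives.
Variables (R : realType) (V : normedModType R).
Implicit Types (x v : V) (f g : V -> R) (a b : R).

Lemma is_derive_funC x v (c : R) : is_derive x v (fun=> c) 0.
Proof. exact: (is_derive_cst c x v). Qed.

Lemma is_derive_funD x v f g a b : is_derive x v f a -> is_derive x v g b ->
  is_derive x v (fun y => f y + g y) (a + b).
Proof. exact: is_deriveD. Qed.

Lemma is_derive_funN x v f a : is_derive x v f a ->
  is_derive x v (fun y => - f y) (- a).
Proof. exact: is_deriveN. Qed.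

Lemma is_derive_funB x v f g a b : is_derive x v f a -> is_derive x v g b ->
  is_derive x v (fun y => f y - g y) (a - b).
Proof. exact: is_deriveB. Qed.

Lemma is_derive_funM x v f g a b : is_derive x v f a -> is_derive x v g b ->
  is_derive x v (fun y => f y * g y) (a * g x + f x * b).
Proof.
move=> fa gb; apply: (is_derive_eq (is_deriveM fa gb)).
by rewrite addrC [a * _]mulrC.
Qed.

Lemma is_derive_funX x v f a n : is_derive x v f a ->
  is_derive x v (fun y => f y ^+ n) (n%:R * f x ^+ n.-1 * a).
Proof.
move=> fa; have -> : (fun y => f y ^+ n) = f ^+ n by apply/funext => y; rewrite fctE.
exact: (is_deriveX n).
Qed.

(** Restriction to a line turns a directional derivative into an ordinary one, so the chain rule
    below asks only for directional derivability of the inner function. *)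
Lemma is_derive_along_line x v f a :
  is_derive x v f a <-> is_derive (0 : R) (1 : R) (fun h : R => f (h *: v + x)) a.
Proof.
have E : (fun h : R => h^-1 *: ((f \o shift x) (h *: v) - f x)) =
    (fun h : R => h^-1 *: (((fun h : R => f (h *: v + x)) \o shift 0) (h *: 1) -
             f ((0 : R) *: v + x))).
  by apply/funext => h; rewrite /= scale0r add0r addr0 [h *: 1]mulr1.
split => -[d e]; constructor.
- by move: d; rewrite /derivable E.
- by rewrite -e /derive E.
- by move: d; rewrite /derivable E.
- by rewrite -e /derive E.
Qed.

Lemma is_derive_fun_comp x v (f : R -> R) (g : V -> R) a b :
  is_derive (g x) (1 : R) f a -> is_derive x v g b ->
  is_derive x v (fun y => f (g y)) (a * b).
Proof.
move=> fa /is_derive_along_line gb; apply/is_derive_along_line.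
apply: (@is_derive1_comp R f (fun h : R => g (h *: v + x))) => //=.
by rewrite scale0r add0r.
Qed.

Lemma is_derive_funV x v f a : f x != 0 -> is_derive x v f a ->
  is_derive x v (fun y => (f y)^-1) (- (f x) ^- 2 * a).
Proof.
move=> fx; apply: (is_derive_fun_comp (f := fun y => y^-1)).
apply: is_derive_eq; first exact: (@is_deriveV _ id (f x) 1 1).
by rewrite /= [_ *: _]mulr1.
Qed.

Lemma is_derive_congr x v f a b : is_derive x v f a -> a = b -> is_derive x v f b.
Proof. by move=> h <-. Qed.

Lemma is_derive_unique x v f a b : is_derive x v f a -> is_derive x v f b -> a = b.
Proof. by move=> [_ <-] [_ <-]. Qed.

Lemma is_derive_fun_sum x v (I : Type) (s : seq I) (P : pred I)
    (F : I -> V -> R) (dF : I -> R) :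
  (forall i, P i -> is_derive x v (F i) (dF i)) ->
  is_derive x v (fun y => \sum_(i <- s | P i) F i y) (\sum_(i <- s | P i) dF i).
Proof.
move=> h; elim: s => [|i s ih].
  by rewrite big_nil; under eq_fun do rewrite big_nil; exact: is_derive_funC.
rewrite big_cons; under eq_fun do rewrite big_cons.
by case: ifPn => // Pi; apply: is_derive_funD => //; apply: h.
Qed.

End DirectionalDerivatives.

Lemma is_derive1P (R : realType) (f : R -> R) s :
  derivable f s 1 -> is_derive s (1 : R) f (derive1 f s).
Proof. by move=> d; rewrite derive1E; exact: derivableP. Qed.

Lemma is_derive1E (R : realType) (f : R -> R) s a :
  is_derive s (1 : R) f a -> derive1 f s = a.
Proof. by move=> [_ <-]; rewrite derive1E. Qed.

(* [notypeclasses refine] keeps the library's instances from closing the premises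
   with derivatives in another shape. *)
Ltac solve_derive :=
  lazymatch goal with
  | |- is_derive _ _ (fun y => @?F y + - @?G y) _ =>
      notypeclasses refine (is_derive_funB _ _); solve_derive
  | |- is_derive _ _ (fun y => @?F y + @?G y) _ =>
      notypeclasses refine (is_derive_funD _ _); solve_derive
  | |- is_derive _ _ (fun y => - @?F y) _ =>
      notypeclasses refine (is_derive_funN _); solve_derive
  | |- is_derive _ _ (fun y => @?F y * @?G y) _ =>
      notypeclasses refine (is_derive_funM _ _); solve_derive
  | |- is_derive _ _ (fun y => @?F y ^+ _) _ =>
      notypeclasses refine (is_derive_funX _ _); solve_derive
  | |- is_derive _ _ (fun y => (@?F y)^-1) _ =>
      notypeclasses refine (is_derive_funV _ _); [ | solve_derive]
  | |- is_derive _ _ (fun y => y) _ => exact: is_derive_id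
  | |- _ => first [eassumption | exact: is_derive_funC | idtac]
  end.

Ltac derive_with := notypeclasses refine (is_derive_congr _ _); [solve_derive | ].

(* The curvatures of the planes tr, ty, ry and yy': A, B_t, B_r and psi. *)
Variant cvar := cA | cT | cR | cS.

Definition cvar_eqb (v w : cvar) : bool :=
  match v, w with
  | cA, cA | cT, cT | cR, cR | cS, cS => true
  | _, _ => false
  end.

Definition cvals (R : Type) (a b c d : R) (v : cvar) : R :=
  match v with cA => a | cT => b | cR => c | cS => d end.

(** Polynomials are kept as syntax: partial derivatives are again expressions, and facts about them
    follow by induction. Only values of expressions are compared, so no normal form is needed. *)
Inductive pexp (R : Type) :=
  | PC of R
  | PV of cvar
  | PA of pexp R & pexp R
  | PM of pexp R & pexp R.
Arguments PV {R} _.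

Section CurvaturePolynomials.
Variable R : realType.
Implicit Types (e : pexp R) (u du : cvar -> R).

Fixpoint ev u e : R :=
  match e with
  | PC c => c
  | PV v => u v
  | PA e1 e2 => ev u e1 + ev u e2
  | PM e1 e2 => ev u e1 * ev u e2
  end.

Fixpoint pd (v : cvar) e : pexp R :=
  match e with
  | PC _ => PC 0
  | PV w => PC (cvar_eqb v w)%:R
  | PA e1 e2 => PA (pd v e1) (pd v e2)
  | PM e1 e2 => PA (PM (pd v e1) e2) (PM e1 (pd v e2))
  end.

Fixpoint psub (s : cvar -> cvar) e : pexp R :=
  match e with
  | PC c => PC c
  | PV v => PV (s v)
  | PA e1 e2 => PA (psub s e1) (psub s e2)
  | PM e1 e2 => PM (psub s e1) (psub s e2)
  end.

Definition psum (I : Type) (r : seq I) (P : pred I) (F : I -> pexp R) :=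
  \big[@PA R/PC 0]_(i <- r | P i) F i.
Definition pprod (I : Type) (r : seq I) (P : pred I) (F : I -> pexp R) :=
  \big[@PM R/PC 1]_(i <- r | P i) F i.

Lemma ev_psum u I (r : seq I) (P : pred I) F :
  ev u (psum r P F) = \sum_(i <- r | P i) ev u (F i).
Proof. by rewrite /psum; elim/big_rec2: _ => //= i x y _ <-. Qed.

Lemma ev_pprod u I (r : seq I) (P : pred I) F :
  ev u (pprod r P F) = \prod_(i <- r | P i) ev u (F i).
Proof. by rewrite /pprod; elim/big_rec2: _ => //= i x y _ <-. Qed.

Lemma ev_psub u s e : ev u (psub s e) = ev (fun v => u (s v)) e.
Proof. by elim: e => //= e1 -> e2 ->. Qed.

Lemma eq_ev u (w : cvar -> R) e : u =1 w -> ev u e = ev w e.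
Proof. by move=> uw; elim: e => //= e1 -> e2 ->. Qed.

Lemma ev_pdC u (v w : cvar) e : ev u (pd v (pd w e)) = ev u (pd w (pd v e)).
Proof. by elim: e => //= e1 -> e2 ->; ring. Qed.

Definition grad u (w : cvar -> R) e : R :=
  ev u (pd cA e) * w cA + ev u (pd cT e) * w cT +
  ev u (pd cR e) * w cR + ev u (pd cS e) * w cS.

Lemma is_derive_ev (V : normedModType R) (x v : V) (u : V -> cvar -> R) du e :
  (forall i, is_derive x v (fun y => u y i) (du i)) ->
  is_derive x v (fun y => ev (u y) e) (grad (u x) du e).
Proof.
move=> hu; elim: e => [c|i|e1 h1 e2 h2|e1 h1 e2 h2] /=.
- by apply: is_derive_eq (is_derive_funC _ _ _) _; rewrite /grad /=; ring.
- by apply: is_derive_eq (hu i) _; rewrite /grad /=; case: i => /=; ring.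
- by apply: is_derive_eq (is_derive_funD h1 h2) _; rewrite /grad /=; ring.
- by apply: is_derive_eq (is_derive_funM h1 h2) _; rewrite /grad /=; ring.
Qed.

Definition homog (n : nat) e :=
  forall (l : R) u, ev (fun v => l * u v) e = l ^+ n * ev u e.

(** Euler's identity: differentiate the scaling law in l at l = 1. *)
Lemma euler_homog n e u : homog n e -> grad u u e = n%:R * ev u e.
Proof.
move=> he.
have d1 : is_derive (1 : R) (1 : R) (fun l => ev (fun v => l * u v) e) (grad u u e).
  rewrite (_ : grad u u e = grad (fun v => 1 * u v) u e); last first.
    by congr (grad _ u e); apply/funext => v; rewrite mul1r.
  apply: (@is_derive_ev R 1 1 (fun l v => l * u v) u e) => i.
  by derive_with; rewrite /=; ring.
apply: is_derive_unique d1 _.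
rewrite (_ : (fun l => _) = (fun l => l ^+ n * ev u e)); last first.
  by apply/funext => l; rewrite he.
by derive_with; rewrite /= expr1n; ring.
Qed.

(** Gives the O(N'^2/N) remainder, with x = N'/N and y = N''/N. By induction; with linear parts l_i
    and remainders r_i, the error of a product X1 X2 is l1 l2 + (a1 + l1) r2 + X2 r1. *)
Lemma ev_taylor2 e u (v w : cvar -> R) : exists2 C : R, 0 <= C & forall x y : R,
  `|x| <= 1 -> `|y| <= 1 ->
  `|ev (fun i => u i + x * v i + y * w i) e
    - (ev u e + x * grad u v e + y * grad u w e)| <= C * (x ^+ 2 + y ^+ 2).
Proof.
elim: e => [c|i|e1 [C1 C1ge0 h1] e2 [C2 C2ge0 h2]|e1 [C1 C1ge0 h1] e2 [C2 C2ge0 h2]].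
- exists 0 => // x y _ _ /=.
  by rewrite /grad /= (_ : c - _ = 0) ?normr0 ?mul0r //; ring.
- exists 0 => // x y _ _ /=; rewrite (_ : _ - _ = 0) ?normr0 ?mul0r //.
  by rewrite /grad /=; case: i => /=; ring.
- exists (C1 + C2) => [|x y hx hy /=]; first exact: addr_ge0.
  have := h1 x y hx hy; have := h2 x y hx hy; rewrite /grad /=.
  set X1 := ev _ e1; set X2 := ev _ e2 => H2 H1.
  rewrite [leRHS]mulrDl; apply: le_trans (lerD H1 H2).
  by apply: le_trans (ler_normD _ _); rewrite le_eqVlt; apply/orP; left; apply/eqP;
     congr `|_|; ring.
- set a1 := ev u e1; set a2 := ev u e2.
  set p1 := grad u v e1 in h1; set q1 := grad u w e1 in h1.
  set p2 := grad u v e2 in h2; set q2 := grad u w e2 in h2.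
  pose M1 := `|p1| + `|q1|; pose M2 := `|p2| + `|q2|.
  (* The three terms bound l1 l2, (a1 + l1) r2 and X2 r1 in this order; the factors 2 come from |x|
     + |y| <= 2 and x^2 + y^2 <= 2. *)
  exists (2 * (M1 * M2) + (`|a1| + 2 * M1) * C2 + (`|a2| + 2 * M2 + 2 * C2) * C1).
    by rewrite !addr_ge0 ?mulr_ge0 ?addr_ge0 ?mulr_ge0 ?addr_ge0.
  move=> x y hx hy /=; have := h1 x y hx hy; have := h2 x y hx hy.
  set X1 := ev _ e1; set X2 := ev _ e2 => H2 H1.
  pose S := x ^+ 2 + y ^+ 2; rewrite -/S in H1 H2 *.
  pose t := `|x| + `|y|.
  have t0 : 0 <= t by rewrite addr_ge0.
  have t2 : t <= 2 by rewrite /t; lra.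
  have S0 : 0 <= S by rewrite addr_ge0 ?sqr_ge0.
  have tt : t * t <= 2 * S.
    rewrite /S -[x ^+ 2]real_normK ?num_real // -[y ^+ 2]real_normK ?num_real // /t.
    by have := sqr_ge0 (`|x| - `|y|); rewrite !expr2; lra.
  have S2 : S <= 2.
    rewrite /S -[x ^+ 2]real_normK ?num_real // -[y ^+ 2]real_normK ?num_real //.
    have := exprn_ile1 2 (normr_ge0 x) hx.
    by have := exprn_ile1 2 (normr_ge0 y) hy; lra.
  have L (p q : R) : `|x * p + y * q| <= t * (`|p| + `|q|).
    apply: (le_trans (ler_normD _ _)); rewrite !normrM /t mulrDl !mulrDr.
    by rewrite lerD ?lerDl ?lerDr ?mulr_ge0.
  have L1 := L p1 q1; have L2 := L p2 q2; rewrite -/M1 -/M2 in L1 L2.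
  set r1 := X1 - _ in H1; set r2 := X2 - _ in H2.
  set l1 := x * p1 + y * q1 in L1; set l2 := x * p2 + y * q2 in L2.
  have M10 : 0 <= M1 by rewrite addr_ge0.
  have M20 : 0 <= M2 by rewrite addr_ge0.
  have B1 : `|a1 + l1| <= `|a1| + 2 * M1.
    by apply: (le_trans (ler_normD _ _)); rewrite lerD2l (le_trans L1) ?ler_wpM2r.
  have B2 : `|X2| <= `|a2| + 2 * M2 + 2 * C2.
    have -> : X2 = a2 + l2 + r2 by rewrite /r2 /l2 /a2; ring.
    apply: (le_trans (ler_normD _ _)); apply: lerD.
      by apply: (le_trans (ler_normD _ _)); rewrite lerD2l (le_trans L2) ?ler_wpM2r.
    by rewrite (le_trans H2) // mulrC ler_wpM2r.
  have B3 : `|l1 * l2| <= 2 * (M1 * M2) * S.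
    rewrite normrM; apply: (le_trans (ler_pM _ _ L1 L2)) => //.
    by rewrite mulrACA [leRHS]mulrAC ler_wpM2r ?mulr_ge0.
  have -> : X1 * X2 - (a1 * a2 + x * grad u v (PM e1 e2) + y * grad u w (PM e1 e2)) =
     l1 * l2 + (a1 + l1) * r2 + X2 * r1.
    by rewrite /r1 /r2 /l1 /l2 /p1 /p2 /q1 /q2 /a1 /a2 /grad /=; ring.
  apply: (le_trans (ler_normD _ _)); rewrite [leRHS]mulrDl.
  apply: lerD.
    apply: (le_trans (ler_normD _ _)); rewrite [leRHS]mulrDl; apply: lerD => //.
    by rewrite normrM -mulrA; apply: ler_pM.
  by rewrite normrM -mulrA; apply: ler_pM.
Qed.

End CurvaturePolynomials.

(** * Curvature of the static metric *)

Definition pair_var (a b : nat) : cvar :=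
  match a, b with
  | 0, 1 | 1, 0 => cA
  | 0, _ | _, 0 => cT
  | 1, _ | _, 1 => cR
  | _, _ => cS
  end.

Section StaticMetricAlgebra.
Variables (R : realFieldType) (N N1 N2 f f1 f2 r q k : R) (X : nat -> R).
Hypotheses (N0 : N != 0) (f0 : f != 0) (r0 : r != 0) (q0 : q != 0).

Definition gdiag (i : nat) : R :=
  match i with 0 => - N ^+ 2 * f | 1 => f^-1 | _ => r ^+ 2 / q ^+ 2 end.

(** The derivative of log sqrt|g_ii| along coordinate j. For a diagonal metric all Christoffel
    symbols are expressed by these and by ratios of diagonal entries. [glog2] is the derivative of
    [glog] along coordinate d. *)
Definition glog (i j : nat) : R :=
  match i, j with
  | 0, 1 => N1 / N + f1 / (2 * f)
  | 1, 1 => - (f1 / (2 * f))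
  | _.+2, 1 => r^-1
  | _.+2, _.+2 => - (k / 2 * X j / q)
  | _, _ => 0
  end.

Definition glog2 (i j d : nat) : R :=
  match i, j, d with
  | 0, 1, 1 => N2 / N - (N1 / N) ^+ 2 + f2 / (2 * f) - f1 ^+ 2 / (2 * f ^+ 2)
  | 1, 1, 1 => - (f2 / (2 * f) - f1 ^+ 2 / (2 * f ^+ 2))
  | _.+2, 1, 1 => - r ^- 2
  | _.+2, _.+2, _.+2 =>
     - (k / 2 * (j == d)%:R / q - (k / 2) ^+ 2 * X j * X d / q ^+ 2)
  | _, _, _ => 0
  end.

(** The Christoffel symbol Gamma^a_bc of a diagonal metric. *)
Definition chris (a b c : nat) : R :=
  (a == c)%:R * glog a b + (a == b)%:R * glog a c
  - (b == c)%:R * (gdiag b / gdiag a) * glog b a.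

Definition dchris (a b c d : nat) : R :=
  (a == c)%:R * glog2 a b d + (a == b)%:R * glog2 a c d
  - (b == c)%:R * (gdiag b / gdiag a) *
    (2 * (glog b d - glog a d) * glog b a + glog2 b a d).

(** Inner product of the gradients of log sqrt|g_aa| and log sqrt|g_dd|, times g_dd. Its y-part k^2
    |y|^2 / (4 q^2) is written with k |y|^2 / 4 = q - 1, so that no sum over coordinates remains. *)
Definition glog_dot (a d : nat) : R :=
  glog a 1 * (gdiag d / gdiag 1) * glog d 1
  + (if (1 < a)%N && (1 < d)%N then k * (q - 1) / q ^+ 2 else 0).

(** Closed form of the sum over e of Gamma^a_ce Gamma^e_db. *)
Definition chris_sq (a b c d : nat) : R :=
  glog a c * chris a d b
  + (a == c)%:R * (glog a b * glog b d + glog a d * glog d b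
                   - (d == b)%:R * glog_dot a d)
  - gdiag c / gdiag a * glog c a * chris c d b.

Definition sectional : cvar -> R :=
  cvals (- (f2 / 2) - 3 / 2 * f1 * (N1 / N) - f * (N2 / N))
         (- f1 / (2 * r) - f / r * (N1 / N)) (- f1 / (2 * r))
         ((k - f) / r ^+ 2).

(** An index matters only through being 0, 1 or at least 2 and through its equalities with the
    others, so finitely many rational identities remain. *)
Lemma riemann_diag (a b c d : nat) :
  dchris a d b c - dchris a c b d + (chris_sq a b c d - chris_sq a b d c)
  = sectional (pair_var a b) * gdiag b *
    ((a == c)%:R * (b == d)%:R - (a == d)%:R * (b == c)%:R).
Proof.
rewrite /dchris /chris_sq /chris /glog_dot.
case: a => [|[|a]]; case: b => [|[|b]]; case: c => [|[|c]]; case: d => [|[|d]];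
 rewrite /= ?eqSS; repeat case: eqVneq => /= *; subst; rewrite //=; try by [ring|
field; rewrite ?N0 ?f0 ?r0 ?q0 ?oppr_eq0 ?sqrf_eq0].
Qed.

End StaticMetricAlgebra.

Lemma near_continuous (T U : topologicalType) (g : T -> U) (x : T) (P : set U) :
  {for x, continuous g} -> nbhs (g x) P -> \forall y \near x, P (g y).
Proof. by move=> c; exact: c. Qed.

(** * The Riemann tensor on the coordinate chart *)

Section StaticMetric.
Variables (R : realType) (D : nat).
Hypothesis D_gt1 : (1 < D)%N.
Implicit Types (k : R) (N f : R -> R) (x y : 'rV[R]_D) (a b c d i : 'I_D).

Definition coord_at x (m : nat) : R := oapp (fun i : 'I_D => x 0 i) 0 (insub m).

Lemma coord_at_ord x i : coord_at x i = x 0 i.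
Proof. by rewrite /coord_at valK. Qed.

Lemma radial_coordE x : radial_coord x = coord_at x 1.
Proof. by []. Qed.

Lemma coord_at_lt x m (hm : (m < D)%N) : coord_at x m = x 0 (Ordinal hm).
Proof. by rewrite -coord_at_ord. Qed.

Lemma continuous_radial_coord : continuous (@radial_coord R D).
Proof.
move=> x; rewrite (_ : @radial_coord R D = fun y => y 0 (Ordinal D_gt1)).
  exact: coord_continuous.
by apply/funext => y; rewrite radial_coordE coord_at_lt.
Qed.

Lemma is_derive_coord x i d :
  is_derive x (delta_mx 0 d) (fun y => y 0 i) (i == d)%:R.
Proof.
apply/is_derive_along_line.
rewrite (_ : (fun h : R => _) = (fun h => h * (i == d)%:R + x 0 i)).
  by derive_with; ring.
by apply/funext => h; rewrite !mxE eqxx.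
Qed.

Lemma is_derive_radial x d :
  is_derive x (delta_mx 0 d) (@radial_coord R D) (d == 1 :> nat)%:R.
Proof.
rewrite (_ : @radial_coord R D = fun y => y 0 (Ordinal D_gt1)).
  by rewrite eq_sym; exact: is_derive_coord.
by apply/funext => y; rewrite radial_coordE coord_at_lt.
Qed.

Lemma is_derive_horizon k x d :
  is_derive x (delta_mx 0 d) (@horizon_factor R D k)
    (if (1 < d)%N then k / 2 * x 0 d else 0).
Proof.
rewrite /horizon_factor.
notypeclasses refine (is_derive_congr _ _).
  notypeclasses refine (is_derive_funD (is_derive_funC _ _ _) _).
  notypeclasses refine (is_derive_funM (is_derive_funC _ _ _) _).
  notypeclasses refine (is_derive_fun_sum _ _) => i _.
  exact: (is_derive_funX 2 (is_derive_coord x i d)).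
rewrite /= mul0r !add0r.
rewrite (eq_bigr (fun i => if i == d then 2 * x 0 d else 0)); last first.
  by move=> i _; rewrite expr1; case: eqVneq => [->|]; rewrite ?mulr1 ?mulr0.
rewrite -big_mkcondr /=; case: ifPn => hd.
  rewrite (big_pred1 d); last by move=> i /=; case: eqVneq => [->|]; rewrite ?hd ?andbF.
  by field.
by rewrite big_pred0 ?mulr0 // => i; case: eqVneq => [->|]; rewrite ?(negbTE hd) ?andbF.
Qed.

Lemma continuous_horizon k : continuous (@horizon_factor R D k).
Proof.
move=> x; rewrite /horizon_factor.
have cs : continuous (fun y : 'rV[R]_D => \sum_(i < D | (2 <= i)%N) y 0 i ^+ 2).
  apply: continuous_big; first exact: add_continuous.
  move=> i _ y; rewrite /continuous_at /=; under eq_fun do rewrite expr2.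
  have ci := @coord_continuous R 1 D 0 i y.
  by rewrite expr2; exact: (cvgM ci ci).
exact: (cvgD (cvg_cst _) (cvgM (cvg_cst _) (cs x))).
Qed.

Definition static_domain k N f x : Prop :=
  [/\ in_chart k x, regular_at f (radial_coord x),
      smooth_near N (radial_coord x) & 0 < N (radial_coord x)].

(** The Riemann tensor differentiates Christoffel symbols, so their closed form must hold in a
    neighbourhood; all the conditions are open. *)
Lemma near_static_domain k N f x :
  static_domain k N f x -> \forall y \near x, static_domain k N f y.
Proof.
move=> [[r0 q0] [_ sf fr] sN Nr].
have cf : continuous_at (radial_coord x) f.
  by apply/differentiable_continuous/derivable1_diffP; exact: (nbhs_singleton sf 0).
have cN : continuous_at (radial_coord x) N.
  by apply/differentiable_continuous/derivable1_diffP; exact: (nbhs_singleton sN 0).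
have nr := near_continuous (continuous_radial_coord (x := x)) (lt_nbhsr r0).
have nq := near_continuous (continuous_horizon (x := x)) (lt_nbhsr q0).
have nf := near_continuous (continuous_radial_coord (x := x)) (near_join sf).
have nN := near_continuous (continuous_radial_coord (x := x)) (near_join sN).
have nf0 := near_continuous (continuous_radial_coord (x := x))
  (near_continuous cf (open_nbhs_nbhs (conj (open_neq (y := 0)) fr))).
have nN0 := near_continuous (continuous_radial_coord (x := x))
  (near_continuous cN (lt_nbhsr Nr)).
apply: filterS (filterI (filterI nr nq) (filterI (filterI nf nf0) (filterI nN nN0))).
move=> y [] [ry qy] [] [sfy fy] [sNy Ny].
have cy : in_chart k y := conj ry qy.
have gy : regular_at f (radial_coord y) := And3 ry sfy fy.
exact: And4 cy gy sNy Ny.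
Qed.

Lemma smooth_nearP f r m : smooth_near f r ->
  is_derive r (1 : R) (derive1n m f) (derive1n m.+1 f r).
Proof. by move=> sf; apply: is_derive1P; exact: (nbhs_singleton sf m). Qed.

Definition gdiag_at k N f (i : nat) x : R :=
  let r := radial_coord x in gdiag (N r) (f r) r (horizon_factor k x) i.

Definition glog_at k N f (i j : nat) x : R :=
  let r := radial_coord x in
  glog (N r) (derive1 N r) (f r) (derive1 f r) r (horizon_factor k x) k (coord_at x) i j.

Definition glog2_at k N f (i j d : nat) x : R :=
  let r := radial_coord x in
  glog2 (N r) (derive1 N r) (derive1n 2 N r) (f r) (derive1 f r) (derive1n 2 f r)
    r (horizon_factor k x) k (coord_at x) i j d.

Lemma gdiag_at_neq0 k N f x (i : nat) : static_domain k N f x -> gdiag_at k N f i x != 0.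
Proof.
move=> [[r0 q0] [_ _ f0] _ N0].
have ? := lt0r_neq0 r0; have ? := lt0r_neq0 q0; have ? := lt0r_neq0 N0.
rewrite /gdiag_at; case: i => [|[|i]] /=.
- by apply: mulf_neq0 => //; rewrite oppr_eq0 sqrf_eq0.
- by rewrite invr_eq0.
- by apply: mulf_neq0; rewrite ?invr_eq0 sqrf_eq0.
Qed.

Lemma is_derive_gdiag k N f x b d : static_domain k N f x ->
  is_derive x (delta_mx 0 d) (gdiag_at k N f b)
    (2 * gdiag_at k N f b x * glog_at k N f b d x).
Proof.
move=> [[r0 q0] [_ sf f0] sN N0].
have ? := lt0r_neq0 r0; have ? := lt0r_neq0 q0; have ? := lt0r_neq0 N0.
have dr := is_derive_radial x d; have dq := is_derive_horizon k x d.
have df : is_derive x (delta_mx 0 d) (fun y => f (radial_coord y))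
    (derive1 f (radial_coord x) * (d == 1 :> nat)%:R).
  exact: is_derive_fun_comp (smooth_nearP 0 sf) dr.
have dN : is_derive x (delta_mx 0 d) (fun y => N (radial_coord y))
    (derive1 N (radial_coord x) * (d == 1 :> nat)%:R).
  exact: is_derive_fun_comp (smooth_nearP 0 sN) dr.
rewrite /gdiag_at /glog_at -(coord_at_ord x d) in dq *.
case: (val b) => [|[|m]] /=.
- derive_with.
  by case: (nat_of_ord d) => [|[|m]] /=; field; do ?[apply/andP; split].
- derive_with => //.
  by case: (nat_of_ord d) => [|[|m]] /=; field.
- derive_with; first by rewrite ?sqrf_eq0.
  by case: (nat_of_ord d) => [|[|e]] /=; field; do ?[apply/andP; split].
Qed.

Lemma is_derive_glog k N f x a b d : static_domain k N f x ->
  is_derive x (delta_mx 0 d) (glog_at k N f a b) (glog2_at k N f a b d x).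
Proof.
move=> [[r0 q0] [_ sf f0] sN N0].
have ? := lt0r_neq0 r0; have ? := lt0r_neq0 q0; have ? := lt0r_neq0 N0.
have dr := is_derive_radial x d; have dq := is_derive_horizon k x d.
have df : is_derive x (delta_mx 0 d) (fun y => f (radial_coord y))
    (derive1 f (radial_coord x) * (d == 1 :> nat)%:R).
  exact: is_derive_fun_comp (smooth_nearP 0 sf) dr.
have dN : is_derive x (delta_mx 0 d) (fun y => N (radial_coord y))
    (derive1 N (radial_coord x) * (d == 1 :> nat)%:R).
  exact: is_derive_fun_comp (smooth_nearP 0 sN) dr.
have df' : is_derive x (delta_mx 0 d) (fun y => derive1 f (radial_coord y))
    (derive1 (derive1 f) (radial_coord x) * (d == 1 :> nat)%:R).
  exact: is_derive_fun_comp (smooth_nearP 1 sf) dr.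
have dN' : is_derive x (delta_mx 0 d) (fun y => derive1 N (radial_coord y))
    (derive1 (derive1 N) (radial_coord x) * (d == 1 :> nat)%:R).
  exact: is_derive_fun_comp (smooth_nearP 1 sN) dr.
have dX : is_derive x (delta_mx 0 d) (fun y => coord_at y b) (b == d :> nat)%:R.
  by under eq_fun do rewrite coord_at_ord; exact: is_derive_coord.
rewrite /glog_at /glog2_at -(coord_at_ord x d) in dq *.
case: (nat_of_ord a) => [|[|m]]; case: (nat_of_ord b) dX => [|[|m']] dX /=;
  try exact: is_derive_funC.
- derive_with => //; first by rewrite mulf_neq0.
  clear dr dq df dN df' dN' dX; rewrite /=.
  move: (derive1 (derive1 N) (radial_coord x)) (derive1 (derive1 f) (radial_coord x)).
  move: (derive1 N (radial_coord x)) (derive1 f (radial_coord x)) => N1 f1 N2 f2.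
  by case: (nat_of_ord d) => [|[|e]] /=; field; do ?[apply/andP; split].
- derive_with => //; first by rewrite mulf_neq0.
  clear dr dq df dN df' dN' dX; rewrite /=.
  move: (derive1 (derive1 f) (radial_coord x)) (derive1 f (radial_coord x)) => f2 f1.
  by case: (nat_of_ord d) => [|[|e]] /=; field; do ?[apply/andP; split].
- derive_with => //.
  by case: (nat_of_ord d) => [|[|e]] /=; field; do ?[apply/andP; split].
- derive_with => //.
  by case: (nat_of_ord d) => [|[|e]] /=; field; do ?[apply/andP; split].
Qed.

Lemma static_metricE k N f x a b :
  static_metric k N f x a b = (a == b)%:R * gdiag_at k N f a x.
Proof.
rewrite /static_metric mxE /gdiag_at; case: eqVneq => _; rewrite ?mul0r ?mul1r //=.
Qed.

Lemma invmx_static_metric k N f x a b : static_domain k N f x ->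
  invmx (static_metric k N f x) a b = (a == b)%:R / gdiag_at k N f a x.
Proof.
move=> dom; pose B := \matrix_(i, j) ((i == j)%:R / gdiag_at k N f i x) : 'M[R]_D.
have AB : static_metric k N f x *m B = 1%:M.
  apply/matrixP => i j; rewrite !mxE (bigD1 i) //= big1 ?addr0 => [|l li].
    rewrite static_metricE !mxE eqxx mul1r mulrCA divff ?mulr1 //.
    exact: gdiag_at_neq0.
  by rewrite static_metricE [i == l]eq_sym (negbTE li) !mul0r.
have [uA _] := mulmx1_unit AB.
by rewrite -[invmx _]mulmx1 -AB mulKmx // mxE.
Qed.

Lemma pderiv_static_metric k N f x a b d : static_domain k N f x ->
  pderiv d (fun y => static_metric k N f y a b) x =
  (a == b)%:R * (2 * gdiag_at k N f a x * glog_at k N f a d x).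
Proof.
move=> dom; rewrite /pderiv; under eq_fun do rewrite static_metricE.
have [_ ->] := is_derive_funM (is_derive_funC x (delta_mx 0 d) (a == b)%:R)
  (is_derive_gdiag a d dom).
by rewrite mul0r add0r.
Qed.

Definition chris_at k N f (a b c : nat) x : R :=
  let r := radial_coord x in
  chris (N r) (derive1 N r) (f r) (derive1 f r) r (horizon_factor k x) k (coord_at x)
    a b c.

Definition dchris_at k N f (a b c d : nat) x : R :=
  let r := radial_coord x in
  dchris (N r) (derive1 N r) (derive1n 2 N r) (f r) (derive1 f r) (derive1n 2 f r)
    r (horizon_factor k x) k (coord_at x) a b c d.

Definition chris_sq_at k N f (a b c d : nat) x : R :=
  let r := radial_coord x in
  chris_sq (N r) (derive1 N r) (f r) (derive1 f r) r (horizon_factor k x) k (coord_at x)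
    a b c d.

Definition sectional_at k N f (r : R) : cvar -> R :=
  sectional (N r) (derive1 N r) (derive1n 2 N r) (f r) (derive1 f r) (derive1n 2 f r) r k.

Lemma chris_atE k N f a b c x :
  chris_at k N f a b c x =
  (a == c)%:R * glog_at k N f a b x + (a == b)%:R * glog_at k N f a c x
  - (b == c)%:R * (gdiag_at k N f b x / gdiag_at k N f a x) * glog_at k N f b a x.
Proof. by []. Qed.

Lemma dchris_atE k N f a b c d x :
  dchris_at k N f a b c d x =
  (a == c)%:R * glog2_at k N f a b d x + (a == b)%:R * glog2_at k N f a c d x
  - (b == c)%:R * (gdiag_at k N f b x / gdiag_at k N f a x) *
    (2 * (glog_at k N f b d x - glog_at k N f a d x) * glog_at k N f b a x
     + glog2_at k N f b a d x).
Proof. by []. Qed.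

Lemma sum_delta (a : 'I_D) (F : 'I_D -> R) : \sum_(e < D) (a == e)%:R * F e = F a.
Proof.
rewrite (bigD1 a) //= eqxx mul1r big1 ?addr0 // => e ea.
by rewrite eq_sym (negbTE ea) mul0r.
Qed.

Lemma christoffel_static k N f a b c x : static_domain k N f x ->
  christoffel (static_metric k N f) a b c x = chris_at k N f a b c x.
Proof.
move=> dom; rewrite /christoffel chris_atE.
under eq_bigr => e _.
  rewrite invmx_static_metric // !pderiv_static_metric // -[_ / _ * _]mulrA.
  over.
rewrite (sum_delta a (fun e => _)).
have ga := gdiag_at_neq0 a dom.
case: (a == c); case: (a == b); case: (b == c); by field.
Qed.

Lemma is_derive_chris k N f a b c d x : static_domain k N f x ->
  is_derive x (delta_mx 0 d) (chris_at k N f a b c) (dchris_at k N f a b c d x).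
Proof.
move=> dom.
have da := is_derive_gdiag a d dom; have db := is_derive_gdiag b d dom.
have lab := is_derive_glog a b d dom; have lac := is_derive_glog a c d dom.
have lba := is_derive_glog b a d dom.
have ga := gdiag_at_neq0 a dom.
rewrite dchris_atE.
apply: (near_eq_is_derive (f := fun y =>
  (a == c)%:R * glog_at k N f a b y + (a == b)%:R * glog_at k N f a c y
  - (b == c)%:R * (gdiag_at k N f b y / gdiag_at k N f a y) * glog_at k N f b a y)).
  by near=> y; rewrite chris_atE.
derive_with => //; rewrite /=. by field.
Unshelve. all: by end_near. Qed.

Lemma sum_glog_dot k N f a d x : static_domain k N f x ->
  \sum_(e < D) glog_at k N f a e x * (gdiag_at k N f d x / gdiag_at k N f e x)
     * glog_at k N f d e x =
  glog_dot (N (radial_coord x)) (derive1 N (radial_coord x)) (f (radial_coord x))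
    (derive1 f (radial_coord x)) (radial_coord x) (horizon_factor k x) k (coord_at x) a d.
Proof.
move=> [[r0 q0] [_ _ f0] _ N0].
have ? := lt0r_neq0 r0; have qn := lt0r_neq0 q0; have ? := lt0r_neq0 N0.
rewrite (bigD1 (Ordinal D_gt1)) //= /glog_dot; congr (_ + _).
case: ifPn => had; last first.
  apply: big1 => e; rewrite -val_eqE /= => e1; move: e1 had.
  rewrite /glog_at; case: (nat_of_ord e) => [|[|m]] //= _;
  by case: (nat_of_ord a) => [|[|?]]; case: (nat_of_ord d) => [|[|?]] //= _;
     rewrite ?mul0r ?mulr0.
have S : k / 4 * \sum_(i < D | (2 <= i)%N) x 0 i ^+ 2 = horizon_factor k x - 1.
  by rewrite /horizon_factor; ring.
rewrite -S mulrAC mulrA big_mkcond /= [in RHS]big_mkcond /= mulr_sumr.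
apply: eq_bigr => e _; rewrite -coord_at_ord -val_eqE /=.
rewrite /glog_at /gdiag_at; move: had.
case: (nat_of_ord a) => [|[|?]] //; case: (nat_of_ord d) => [|[|?]] //= _.
case: (nat_of_ord e) => [|[|m]] //=; rewrite ?mul0r ?mulr0 //.
by field; do ?[apply/andP; split].
Qed.

Lemma sum_chris_sq k N f a b c d x : static_domain k N f x ->
  \sum_(e < D) chris_at k N f a c e x * chris_at k N f e d b x =
  chris_sq_at k N f a b c d x.
Proof.
move=> dom.
have E1 : \sum_(e < D) glog_at k N f a e x * chris_at k N f e d b x =
  glog_at k N f a b x * glog_at k N f b d x + glog_at k N f a d x * glog_at k N f d b x
  - (d == b)%:R * glog_dot (N (radial_coord x)) (derive1 N (radial_coord x))
    (f (radial_coord x)) (derive1 f (radial_coord x)) (radial_coord x)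
    (horizon_factor k x) k (coord_at x) a d.
  rewrite -sum_glog_dot // mulr_sumr.
  rewrite -(sum_delta b (fun e => glog_at k N f a e x * glog_at k N f e d x)).
  rewrite -(sum_delta d (fun e => glog_at k N f a e x * glog_at k N f e b x)).
  rewrite -big_split -sumrB /=; apply: eq_bigr => e _; rewrite chris_atE.
  by rewrite ?val_eqE [e == b]eq_sym [e == d]eq_sym; ring.
(* Of the three terms of Gamma^a_ce, those with delta_ae and delta_ce collapse the sum; the one with
   delta_ac leaves the sum computed in [E1]. *)
rewrite /chris_sq_at /chris_sq.
rewrite -[RHS]/(glog_at k N f a c x * chris_at k N f a d b x + (a == c)%:R *
  (glog_at k N f a b x * glog_at k N f b d x + glog_at k N f a d x * glog_at k N f d b x
  - (d == b)%:R * glog_dot (N (radial_coord x)) (derive1 N (radial_coord x))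
    (f (radial_coord x)) (derive1 f (radial_coord x)) (radial_coord x)
    (horizon_factor k x) k (coord_at x) a d)
  - gdiag_at k N f c x / gdiag_at k N f a x * glog_at k N f c a x *
    chris_at k N f c d b x) -E1 mulr_sumr.
rewrite -(sum_delta a (fun e => glog_at k N f a c x * chris_at k N f e d b x)).
rewrite -(sum_delta c (fun e => gdiag_at k N f c x / gdiag_at k N f a x *
  glog_at k N f c a x * chris_at k N f e d b x)).
rewrite -big_split -sumrB /=; apply: eq_bigr => e _.
by rewrite (chris_atE k N f a c e x) ?val_eqE; ring.
Qed.

Lemma riemann_static k N f a b c d x : static_domain k N f x ->
  riemann (static_metric k N f) a b c d x =
  sectional_at k N f (radial_coord x) (pair_var a b) *
  (gdiag_at k N f a x * gdiag_at k N f b x) *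
  ((a == c)%:R * (b == d)%:R - (a == d)%:R * (b == c)%:R).
Proof.
move=> dom; have ndom := near_static_domain dom.
have dG (i j l m : 'I_D) : pderiv m (christoffel (static_metric k N f) i j l) x =
    dchris_at k N f i j l m x.
  rewrite /pderiv (@near_eq_derive _ _ _ _ (chris_at k N f i j l)); last first.
    by apply: filterS ndom => y /christoffel_static ->.
  by case: (is_derive_chris i j l m dom).
rewrite /riemann (eq_bigr (fun e => (a == e)%:R *
    (gdiag_at k N f a x * riemann_up (static_metric k N f) e b c d x))); last first.
  by move=> e _; rewrite static_metricE mulrA.
rewrite (sum_delta a (fun e => _ * riemann_up _ e b c d x)) /riemann_up !dG.
rewrite (eq_bigr (fun e : 'I_D => chris_at k N f a c e x * chris_at k N f e d b x
  - chris_at k N f a d e x * chris_at k N f e c b x)); last first.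
  by move=> e _; rewrite !christoffel_static.
rewrite sumrB !sum_chris_sq //.
case: dom => [[r0 q0] [_ _ f0] _ N0].
have H := riemann_diag (derive1 N (radial_coord x)) (derive1n 2 N (radial_coord x))
  (derive1 f (radial_coord x)) (derive1n 2 f (radial_coord x)) k (coord_at x)
  (lt0r_neq0 N0) f0 (lt0r_neq0 r0) (lt0r_neq0 q0) a b c d.
rewrite /dchris_at /chris_sq_at H /sectional_at /gdiag_at ?val_eqE; ring.
Qed.

End StaticMetric.

(** * Contractions *)

(** Both products equal the product over v of h v to the number of times v is attained. *)
Lemma prod_eq_count (R : comNzSemiRingType) (J K V : finType) (t : J -> V) (u : K -> V)
    (h : V -> R) :
  (forall v, \sum_j (t j == v) = \sum_l (u l == v))%N ->
  \prod_j h (t j) = \prod_l h (u l).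
Proof.
have E (I : finType) (w : I -> V) :
    \prod_i h (w i) = \prod_v h v ^+ (\sum_i (w i == v))%N.
  under [RHS]eq_bigr => v _ do rewrite expr_sum.
  rewrite exchange_big /=; apply: eq_bigr => i _.
  rewrite (bigD1 (w i)) //= eqxx expr1 big1 ?mulr1 // => v.
  by rewrite eq_sym => /negbTE ->.
by move=> eqc; rewrite !E; apply: eq_bigr => v _; rewrite eqc.
Qed.

Lemma big_prod_type (R : Type) (idx : R) (op : Monoid.com_law idx) (J K : finType)
    (F : J * K -> R) :
  \big[op/idx]_p F p = \big[op/idx]_j \big[op/idx]_l F (j, l).
Proof. by rewrite pair_bigA; apply: eq_bigr => -[]. Qed.

Section Contractions.
Variables (R : realType) (D n : nat).
Hypothesis D_gt1 : (1 < D)%N.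
Implicit Types (s : {perm slot n}) (i : {ffun slot n -> 'I_D}).

Definition riemann_weight i (m : 'I_n) : R :=
  (i (m, false, false) == i (m, true, false))%:R
    * (i (m, false, true) == i (m, true, true))%:R
  - (i (m, false, false) == i (m, true, true))%:R
    * (i (m, false, true) == i (m, true, false))%:R.

Definition metric_weight s i : R :=
  \prod_(mp : 'I_n * bool) (i (s (mp, false)) == i (s (mp, true)))%:R.

(** What is left of a term of the contraction once the curvatures and all metric entries are split
    off. Only equalities of indices enter, hence neither k, f nor N. *)
Definition contraction_weight s i : R :=
  \prod_m riemann_weight i m * metric_weight s i.

Lemma riemann_weight_neq0 i m : riemann_weight i m != 0 ->
  (i (m, false, false) = i (m, true, false) /\ i (m, false, true) = i (m, true, true)) \/
  (i (m, false, false) = i (m, true, true) /\ i (m, false, true) = i (m, true, false)).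
Proof.
rewrite /riemann_weight.
case: (eqVneq (i (m, false, false)) (i (m, true, false))) => ? /=;
case: (eqVneq (i (m, false, true)) (i (m, true, true))) => ? /=;
case: (eqVneq (i (m, false, false)) (i (m, true, true))) => ? /=;
case: (eqVneq (i (m, false, true)) (i (m, true, false))) => ? /=;
rewrite ?(mulr0, mul0r, subrr, eqxx) // => _;
  by [left|right].
Qed.

(* Both products run over half of the slots, and each index value occurs in exactly
   half of the slots carrying it: the metric pairs equal indices, and so does a
   nonzero Riemann component. *)
Lemma metric_factors_cancel s i (h : 'I_D -> R) : contraction_weight s i != 0 ->
  \prod_(m < n) (h (i (m, false, false)) * h (i (m, false, true))) =
  \prod_(mp : 'I_n * bool) h (i (s (mp, false))).
Proof.
rewrite mulf_eq0 negb_or => /andP[/prodf_neq0 wR /prodf_neq0 wM].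
have -> : \prod_(m < n) (h (i (m, false, false)) * h (i (m, false, true))) =
    \prod_(mp : 'I_n * bool) h (i (mp.1, false, mp.2)).
  rewrite big_prod_type /=.
  by apply: eq_bigr => m _; rewrite big_bool mulrC.
apply: prod_eq_count => v; apply/eqP.
rewrite -(eqn_pmul2l (m := 2)) // !big_distrr /=; apply/eqP.
transitivity (\sum_(sl : slot n) (i sl == v))%N.
  rewrite !big_prod_type /=.
  apply: eq_bigr => m _; rewrite !big_bool /=.
  have [[<- <-]|[<- <-]] := riemann_weight_neq0 (wR m isT).
    by case: (i (m, false, false) == v); case: (i (m, false, true) == v).
  by case: (i (m, false, false) == v); case: (i (m, false, true) == v).
rewrite (reindex_inj (@perm_inj _ s)) /=.
rewrite big_prod_type /=.
apply: eq_bigr => mp _; rewrite big_bool /=.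
have := wM mp isT; rewrite pnatr_eq0 eqb0 negbK => /eqP ->.
by rewrite mul2n addnn.
Qed.

Definition contraction_pexp s : pexp R :=
  psum (index_enum {ffun slot n -> 'I_D}) predT (fun i =>
    PM (PC (contraction_weight s i))
       (pprod (index_enum 'I_n) predT (fun m =>
          PV (pair_var (i (m, false, false)) (i (m, false, true)))))).

Definition density_pexp (Z : density R n) : pexp R :=
  psum (index_enum {perm slot n}) predT (fun s => PM (PC (Z s)) (contraction_pexp s)).

Lemma ev_density_pexp (Z : density R n) u : ev u (density_pexp Z) =
  \sum_s Z s * \sum_(i : {ffun slot n -> 'I_D}) contraction_weight s i *
    \prod_(m < n) u (pair_var (i (m, false, false)) (i (m, false, true))).
Proof.
rewrite ev_psum; apply: eq_bigr => s _ /=; rewrite ev_psum.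
by congr (_ * _); apply: eq_bigr => i _ /=; rewrite ev_pprod.
Qed.

Lemma homog_density_pexp (Z : density R n) : homog n (density_pexp Z).
Proof.
move=> l u; rewrite !ev_density_pexp mulr_sumr; apply: eq_bigr => s _.
rewrite [RHS]mulrCA; congr (_ * _); rewrite mulr_sumr; apply: eq_bigr => i _.
by rewrite [RHS]mulrCA big_split /= prodr_const card_ord.
Qed.

Lemma eval_density_static (Z : density R n) k N f (x : 'rV[R]_D) :
  static_domain k N f x ->
  eval_density Z (static_metric k N f) x =
  ev (sectional_at k N f (radial_coord x)) (density_pexp Z).
Proof.
move=> dom; rewrite ev_density_pexp; apply: eq_bigr => s _; congr (_ * _).
apply: eq_bigr => i _.
under eq_bigr => m _ do rewrite riemann_static //.
under [X in _ * X]eq_bigr => mp _ do rewrite invmx_static_metric //.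
rewrite !big_split /= prodfV.
have hc := @metric_factors_cancel s i (fun a => gdiag_at k N f a x).
rewrite -big_split /=; move: hc; rewrite /contraction_weight.
rewrite -/(metric_weight s i); set W := \prod_m riemann_weight i m.
set A := \prod_m _; set G := \prod_m _.
set B := \prod_m _.
have G0 : G != 0 by apply/prodf_neq0 => mp _; exact: gdiag_at_neq0.
(* A term of weight zero vanishes on both sides; otherwise the metric entries of the Riemann tensors
   cancel those of the inverse metrics. *)
have [w0 _|_ /(_ isT) ->] := eqVneq (W * metric_weight s i) 0.
  rewrite [LHS](_ : _ = (W * metric_weight s i) * (A * B / G)); last by ring.
  by rewrite w0 !mul0r.
by field.
Qed.

Definition swapTR (v : cvar) : cvar :=
  match v with cT => cR | cR => cT | _ => v end.

(** Relabelling the index values by the transposition of t and r keeps every weight, fixes the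
    planes tr and yy', and exchanges ty with ry. *)
Lemma ev_density_swap (Z : density R n) u :
  ev (fun v => u (swapTR v)) (density_pexp Z) = ev u (density_pexp Z).
Proof.
rewrite !ev_density_pexp; apply: eq_bigr => s _; congr (_ * _).
pose p : {perm 'I_D} := tperm (Ordinal (ltnW D_gt1)) (Ordinal D_gt1).
pose P i : {ffun slot n -> 'I_D} := [ffun sl => p (i sl)].
have Pinj : injective P.
  by move=> i j /ffunP ij; apply/ffunP => sl; have := ij sl; rewrite !ffunE => /perm_inj.
rewrite [RHS](reindex_inj Pinj) /=; apply: eq_bigr => i _; congr (_ * _).
  rewrite /contraction_weight /metric_weight; congr (_ * _).
    by apply: eq_bigr => m _; rewrite /riemann_weight !ffunE !(inj_eq perm_inj).
  by apply: eq_bigr => mp _; rewrite !ffunE (inj_eq perm_inj).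
apply: eq_bigr => m _; rewrite !ffunE; congr (u _).
have pE (a : 'I_D) : p a = (match nat_of_ord a with 0 => 1 | 1 => 0 | _ => a end)%N :> nat.
  rewrite /p; case: tpermP => [->|->|/eqP + /eqP] //.
  by rewrite -!val_eqE /=; case: (nat_of_ord a) => [|[|]].
rewrite !pE.
by case: (nat_of_ord (i (m, false, false))) => [|[|?]];
   case: (nat_of_ord (i (m, false, true))) => [|[|?]].
Qed.

End Contractions.

(** * Reduced Lagrangian *)

Section Jets.
Variable R : realType.
Implicit Types (f : R -> R) (r s : R) (p : {poly R}).

Lemma derive1n_horner p m : derive1n m (horner p) = horner (derivn m p).
Proof. by elim: m => //= m ->; rewrite -derivE. Qed.

Lemma smooth_near_horner p r : smooth_near (horner p) r.
Proof.
rewrite /smooth_near; apply: filterE => s m; rewrite derive1n_horner; exact: derivable_horner.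
Qed.

Lemma near_eq_derive1 f g r :
  (\near r, f r = g r) -> \near r, derive1 f r = derive1 g r.
Proof.
move=> /near_join fg; apply: filterS fg => s fg.
by rewrite !derive1E; apply: near_eq_derive.
Qed.

Lemma near_eq_derive1_at f g r : (\near r, f r = g r) -> derive1 f r = derive1 g r.
Proof. by move=> /near_eq_derive1/nbhs_singleton. Qed.

Lemma near_regular_at f r : regular_at f r -> \forall s \near r, regular_at f s.
Proof.
move=> [r0 sf f0].
have cf : {for r, continuous f}.
  by apply/differentiable_continuous/derivable1_diffP; exact: (nbhs_singleton sf 0).
have nf0 := near_continuous cf (open_nbhs_nbhs (conj (open_neq (y := 0)) f0)).
apply: filterS (filterI (lt_nbhsr r0) (filterI (near_join sf) nf0)).
by move=> s [s0 [sfs fs]]; exact: (And3 s0 sfs fs).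
Qed.

(** Polynomials are smooth everywhere, so they provide test functions f and N with independently
    prescribed derivatives at r. *)
Lemma exists_jet (r a0 a1 a2 a3 a4 : R) : exists p,
  [/\ p.[r] = a0, derive1 (horner p) r = a1, derive1n 2 (horner p) r = a2,
      derive1n 3 (horner p) r = a3 & derive1n 4 (horner p) r = a4].
Proof.
have [X X0 dX0] : exists2 X : {poly R}, X.[r] = 0 & X^`()%R = 1.
  by exists ('X - r%:P); rewrite ?hornerE ?subrr // derivB derivX derivC subr0.
have dX m : ((X ^+ m.+1)^`() = m.+1%:R *: X ^+ m)%R.
  by rewrite deriv_exp dX0 mul1r scaler_nat.
have dE := (derivD, derivZ, dX, dX0, derivC, scalerA, expr1, alg_polyC, add0r).
pose p := a0%:P + a1 *: X + (a2 / 2) *: X ^+ 2 + (a3 / 6) *: X ^+ 3 + (a4 / 24) *: X ^+ 4.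
have d1 : (p^`() = a1%:P + (a2 / 2 * 2) *: X + (a3 / 6 * 3) *: X ^+ 2
    + (a4 / 24 * 4) *: X ^+ 3)%R.
  by rewrite /p !dE.
have d2 : (p^`(2) = (a2 / 2 * 2)%:P + (a3 / 6 * 3 * 2) *: X
    + (a4 / 24 * 4 * 3) *: X ^+ 2)%R.
  by rewrite derivnS derivn1 d1 !dE.
have d3 : (p^`(3) = (a3 / 6 * 3 * 2)%:P + (a4 / 24 * 4 * 3 * 2) *: X)%R.
  by rewrite derivnS d2 !dE.
have d4 : (p^`(4) = (a4 / 24 * 4 * 3 * 2)%:P)%R by rewrite derivnS d3 !dE.
exists p; rewrite -[derive1 _]/(derive1n 1 _) !derive1n_horner derivn1 d1 d2 d3 d4 /p.
by split; rewrite !hornerE ?X0 /=; field.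
Qed.

Definition curv k r a b c : cvar -> R :=
  cvals (- (c / 2)) (- b / (2 * r)) 0 ((k - a) / r ^+ 2).

Definition curv_of k f s : cvar -> R := curv k s (f s) (derive1 f s) (derive1n 2 f s).

Definition dcurv_of k f s : cvar -> R :=
  cvals (- (derive1n 3 f s / 2)) ((curv_of k f s cA - curv_of k f s cT) / s) 0
    (2 * (curv_of k f s cT - curv_of k f s cS) / s).

Lemma is_derive_curv k f s v : regular_at f s ->
  is_derive s (1 : R) (fun t => curv_of k f t v) (dcurv_of k f s v).
Proof.
move=> [s0 sf f0]; have s0' := lt0r_neq0 s0.
have d2s : is_derive s (1 : R) ( *%R 2) 2.
  apply: is_derive_congr (is_derive_funM (is_derive_funC s 1 2) (is_derive_id s 1)) _.
  by ring.
have d0 : is_derive s (1 : R) f (derive1 f s) := smooth_nearP 0 sf.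
have d1 : is_derive s (1 : R) (derive1 f) (derive1n 2 f s) := smooth_nearP 1 sf.
have d2 : is_derive s (1 : R) (derive1n 2 f) (derive1n 3 f s) := smooth_nearP 2 sf.
rewrite /dcurv_of /curv_of /curv.
move: (derive1n 3 f s) d2 => f3; move: (derive1n 2 f) d1 => f2.
move: (derive1 f) d0 => f1 d0 d1 d2.
case: v; rewrite /cvals.
- by derive_with => //; rewrite /=; field.
- derive_with => /=; first by rewrite mulf_neq0.
  by field.
- exact: is_derive_funC.
- derive_with => /=; first by rewrite sqrf_eq0.
  by field.
Qed.

Lemma is_derive_ev_curv k f s (e : pexp R) : regular_at f s ->
  is_derive s (1 : R) (fun t => ev (curv_of k f t) e)
    (grad (curv_of k f s) (dcurv_of k f s) e).
Proof. by move=> reg; apply: is_derive_ev => v; exact: is_derive_curv. Qed.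

End Jets.

(** * The density and its variational expressions on a given f *)

Section OnShell.
Variables (R : realType) (D n : nat) (Z : density R n).
Hypothesis D_gt1 : (1 < D)%N.
Implicit Types (k r : R) (N f : R -> R).

(* Identifies B_r with B_t, so that the third argument of [cvals] becomes a dummy and
   is set to 0 below. *)
Definition merge (v : cvar) : cvar := match v with cR => cT | _ => v end.
Definition onshell_pexp : pexp R := psub merge (density_pexp D Z).

Lemma radial_on_axis r : radial_coord (on_axis D r) = r.
Proof. by rewrite radial_coordE (coord_at_lt _ D_gt1) mxE. Qed.

Lemma horizon_on_axis k r : horizon_factor k (on_axis D r) = 1.
Proof.
rewrite /horizon_factor big1 ?mulr0 ?addr0 // => i hi.
by rewrite mxE gtn_eqF // expr0n.
Qed.

Lemma on_axis_domain k N f r : regular_at f r -> smooth_near N r -> 0 < N r ->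
  static_domain k N f (on_axis D r).
Proof.
move=> reg sN N0; rewrite /static_domain /in_chart radial_on_axis horizon_on_axis.
by split => //; split => //; case: reg.
Qed.

Lemma radial_on_shell_NE k N f r : regular_at f r -> smooth_near N r -> 0 < N r ->
  radial_on_shell_N D k Z N f r = ev (sectional_at k N f r) (density_pexp D Z).
Proof.
move=> reg sN N0; rewrite /radial_on_shell_N /on_shell_N.
by rewrite (eval_density_static D_gt1 Z (on_axis_domain k reg sN N0)) radial_on_axis.
Qed.

Lemma smooth_near_cst (c r : R) : smooth_near (fun=> c) r.
Proof.
rewrite (_ : (fun=> c) = horner c%:P); first exact: smooth_near_horner.
by apply/funext => s; rewrite hornerC.
Qed.

Lemma sectional_at1 k f r : 0 < r ->
  ev (sectional_at k (fun=> 1) f r) (density_pexp D Z) = ev (curv_of k f r) onshell_pexp.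
Proof.
move=> r0; have r0' := lt0r_neq0 r0.
rewrite ev_psub; apply: eq_ev => v.
have d1 : derive1 (fun=> 1 : R) = (fun=> 0).
  by apply/funext => s; exact: derive1_cst.
have d2 : derive1n 2 (fun=> 1 : R) r = 0 by rewrite /= d1; exact: derive1_cst.
rewrite /sectional_at d2 d1 /curv_of /curv; case: v => /=; by field.
Qed.

Lemma on_shellE k f (x : 'rV[R]_D) : in_chart k x -> regular_at f (radial_coord x) ->
  on_shell k Z f x = ev (curv_of k f (radial_coord x)) onshell_pexp.
Proof.
move=> cx reg; rewrite /on_shell /on_shell_N.
have dom : static_domain k (fun=> 1) f x.
  by split => //; exact: smooth_near_cst.
by rewrite (eval_density_static D_gt1 Z dom) sectional_at1 //; case: reg.
Qed.

Lemma on_shell_jetE k r a b c : 0 < r -> a != 0 ->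
  on_shell_jet D k Z r a b c = ev (curv k r a b c) onshell_pexp.
Proof.
move=> r0 a0; rewrite /on_shell_jet.
pose X := 'X - r%:P; pose p := a%:P + b *: X + (c / 2) *: X ^+ 2.
have pE : (fun s => a + b * (s - r) + c / 2 * (s - r) ^+ 2) = horner p.
  by apply/funext => s; rewrite /p /X !hornerE.
have dX : (X^`() = 1)%R by rewrite /X derivB derivX derivC subr0.
have X0 : X.[r] = 0 by rewrite /X !hornerE subrr.
have d1 : (p^`() = b%:P + c *: X)%R.
  rewrite /p !derivD !derivZ deriv_exp dX derivC add0r alg_polyC mul1r expr1.
  by rewrite -[X *+ 2]scaler_nat scalerA divfK.
have d2 : (p^`(2) = c%:P)%R.
  by rewrite derivnS derivn1 d1 derivD derivZ dX derivC add0r alg_polyC.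
have pr : p.[r] = a by rewrite /p !hornerE subrr /=; ring.
have reg : regular_at (horner p) r.
  by split => //; [exact: smooth_near_horner | rewrite pr].
rewrite pE radial_on_shell_NE //; last exact: smooth_near_cst.
rewrite sectional_at1 // /curv_of pr -[derive1 _]/(derive1n 1 _) !derive1n_horner.
by rewrite derivn1 d1 d2 !hornerE ?X0 ?subrr mulr0 addr0.
Qed.

Lemma is_derive_jet2 k r a b c : 0 < r -> a != 0 ->
  is_derive c (1 : R) (fun c' => on_shell_jet D k Z r a b c')
    (- 2^-1 * ev (curv k r a b c) (pd cA onshell_pexp)).
Proof.
move=> r0 a0.
under eq_fun do rewrite on_shell_jetE //.
notypeclasses refine (is_derive_congr _ _).
  apply: (@is_derive_ev R R c 1 (curv k r a b) (cvals (- 2^-1) 0 0 0)) => v.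
  rewrite /curv; case: v; rewrite /cvals; try exact: is_derive_funC.
  apply: is_derive_congr (is_derive_funN (is_derive_funM (is_derive_id c 1)
    (is_derive_funC _ _ 2^-1))) _; ring.
by rewrite /grad /=; ring.
Qed.

Lemma is_derive_jet1 k r a b c : 0 < r -> a != 0 ->
  is_derive b (1 : R) (fun b' => on_shell_jet D k Z r a b' c)
    (- (2 * r)^-1 * ev (curv k r a b c) (pd cT onshell_pexp)).
Proof.
move=> r0 a0; have r0' := lt0r_neq0 r0.
under eq_fun do rewrite on_shell_jetE //.
notypeclasses refine (is_derive_congr _ _).
  apply: (@is_derive_ev R R b 1 (fun b' => curv k r a b' c)
    (cvals 0 (- (2 * r)^-1) 0 0)) => v.
  rewrite /curv; case: v; rewrite /cvals; try exact: is_derive_funC.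
  apply: is_derive_congr (is_derive_funM (is_derive_funN (is_derive_id b 1))
    (is_derive_funC _ _ (2 * r)^-1)) _; ring.
by rewrite /grad /=; ring.
Qed.

Lemma is_derive_jet0 k r a b c : 0 < r -> a != 0 ->
  is_derive a (1 : R) (fun a' => on_shell_jet D k Z r a' b c)
    (- r ^- 2 * ev (curv k r a b c) (pd cS onshell_pexp)).
Proof.
move=> r0 a0; have r0' := lt0r_neq0 r0.
(* The polynomial form of the jet is established only for a nonzero value of f, since the metric
   degenerates at f = 0. This condition is open, so the derivative at a sees nothing else. *)
have na : \forall a' \near a, a' != 0 := open_nbhs_nbhs (conj (open_neq (y := 0)) a0).
apply: (near_eq_is_derive (f := fun a' => ev (curv k r a' b c) onshell_pexp)).
  by apply: filterS na => a' a'0; rewrite on_shell_jetE.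
notypeclasses refine (is_derive_congr _ _).
  apply: (@is_derive_ev R R a 1 (fun a' => curv k r a' b c)
    (cvals 0 0 0 (- r ^- 2))) => v.
  rewrite /curv; case: v; rewrite /cvals; try exact: is_derive_funC.
  apply: is_derive_congr (is_derive_funM (is_derive_funB (is_derive_funC a 1 k)
    (is_derive_id a 1)) (is_derive_funC _ _ (r ^+ 2)^-1)) _; ring.
by rewrite /grad /=; ring.
Qed.

Section AlongCurves.
Variables (k : R) (f : R -> R) (h : R -> R) (r : R).
Hypothesis reg : regular_at f r.
(** The weight h is r^(D-2) for the Euler-Lagrange expression and 1 for the quasi-topological
    condition. *)
Let L : jet_function R := fun r a b c => h r * on_shell_jet D k Z r a b c.

Lemma along_d2E : along (jet_d2 L) f r
  = h r * (- 2^-1 * ev (curv_of k f r) (pd cA onshell_pexp)).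
Proof.
case: reg => r0 _ f0; apply: is_derive1E.
apply: is_derive_congr (is_derive_funM (is_derive_funC _ _ _) (is_derive_jet2 _ _ _ r0 f0)) _.
by rewrite mul0r add0r.
Qed.

Lemma along_d1E : along (jet_d1 L) f r
  = h r * (- (2 * r)^-1 * ev (curv_of k f r) (pd cT onshell_pexp)).
Proof.
case: reg => r0 _ f0; apply: is_derive1E.
apply: is_derive_congr (is_derive_funM (is_derive_funC _ _ _) (is_derive_jet1 _ _ _ r0 f0)) _.
by rewrite mul0r add0r.
Qed.

Lemma along_d0E : along (jet_d0 L) f r
  = h r * (- r ^- 2 * ev (curv_of k f r) (pd cS onshell_pexp)).
Proof.
case: reg => r0 _ f0; apply: is_derive1E.
apply: is_derive_congr (is_derive_funM (is_derive_funC _ _ _) (is_derive_jet0 _ _ _ r0 f0)) _.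
by rewrite mul0r add0r.
Qed.

End AlongCurves.

(* The quasi-topological condition multiplied by - 4 r, in terms of the curvatures [v]
   at r and their radial derivatives [dv]. *)
Definition qt_value (r : R) (v dv : cvar -> R) : R :=
  let Q i := pd i onshell_pexp in
  2 * (D%:R - 2) * ev v (Q cA) + 2 * r * grad v dv (Q cA) + (D%:R - 4) * ev v (Q cT)
  + r * grad v dv (Q cT) - 4 * ev v (Q cS).

Lemma quasi_topological_eq k f r : quasi_topological D k Z -> regular_at f r ->
  qt_value r (curv_of k f r) (dcurv_of k f r) = 0.
Proof.
move=> [_ QT] reg; have := QT f r reg; rewrite /qt_value /=.
have nreg := near_regular_at reg.
have r0 : r != 0 by case: reg => /lt0r_neq0.
have -> : on_shell_jet D k Z = fun r a b c => 1 * on_shell_jet D k Z r a b c.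
  by apply/funext => ?; apply/funext => ?; apply/funext => ?; apply/funext => ?; rewrite mul1r.
rewrite (along_d2E k (fun=> 1) reg) (along_d1E k (fun=> 1) reg) (along_d0E k (fun=> 1) reg).
rewrite (@near_eq_derive1_at _ (along (jet_d2 _) f)
  (fun s => - 2^-1 * ev (curv_of k f s) (pd cA onshell_pexp))); last first.
  by apply: filterS nreg => s /(along_d2E k (fun=> 1)) ->; rewrite mul1r.
rewrite (@near_eq_derive1_at _ (along (jet_d1 _) f)
  (fun s => - (2 * s)^-1 * ev (curv_of k f s) (pd cT onshell_pexp))); last first.
  by apply: filterS nreg => s /(along_d1E k (fun=> 1)) ->; rewrite mul1r.
have dA := is_derive_ev_curv k (pd cA onshell_pexp) reg.
have dT := is_derive_ev_curv k (pd cT onshell_pexp) reg.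
rewrite (is_derive1E (is_derive_funM (is_derive_funC _ _ _) dA)).
have d2s : is_derive r (1 : R) (fun s => 2 * s) 2.
  apply: is_derive_congr (is_derive_funM (is_derive_funC r 1 2) (is_derive_id r 1)) _.
  by ring.
have d2r : 2 * r != 0 by rewrite mulf_neq0.
rewrite (is_derive1E (is_derive_funM (is_derive_funN (is_derive_funV d2r d2s)) dT)).
move=> /(congr1 ( *%R (- (4 * r)))); rewrite mulr0 => <-.
by field.
Qed.

(** The terms L_f, (L_f')' and (L_f'')'' written out. The fourth derivative [f4] of f occurs once,
    multiplied by Q_AA. *)
Definition el_value (r : R) (v dv : cvar -> R) (f4 : R) : R :=
  let Q i := pd i onshell_pexp in
  let QA i := pd i (Q cA) in
  let m := (D - 2)%N in
  r ^+ m * (- r ^- 2 * ev v (Q cS))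
  - (m%:R * r ^+ m.-1 * (- (2 * r)^-1 * ev v (Q cT))
     + r ^+ m * ((2 * r ^+ 2)^-1 * ev v (Q cT) - (2 * r)^-1 * grad v dv (Q cT)))
  + (m%:R * (m.-1%:R * r ^+ m.-2) * (- 2^-1 * ev v (Q cA))
     - m%:R * r ^+ m.-1 * grad v dv (Q cA)
     - 2^-1 * r ^+ m *
      (grad v dv (QA cA) * dv cA + ev v (QA cA) * (- (f4 / 2))
       + grad v dv (QA cT) * ((v cA - v cT) / r)
       + ev v (QA cT) * ((dv cA - dv cT) / r - (v cA - v cT) / r ^+ 2)
       + grad v dv (QA cS) * (2 * (v cT - v cS) / r)
       + ev v (QA cS) * (2 * (dv cT - dv cS) / r - 2 * (v cT - v cS) / r ^+ 2))).

Lemma euler_lagrangeE k f r : regular_at f r ->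
  euler_lagrange (fun r a b c => r ^+ (D - 2) * on_shell_jet D k Z r a b c) f r =
  el_value r (curv_of k f r) (dcurv_of k f r) (derive1n 4 f r).
Proof.
move=> reg; have nreg := near_regular_at reg.
have r0 : r != 0 by case: reg => /lt0r_neq0.
set m := (D - 2)%N; pose h (s : R) := s ^+ m.
rewrite /euler_lagrange (along_d0E k h reg).
rewrite (@near_eq_derive1_at _ (along (jet_d1 _) f)
  (fun s => s ^+ m * (- (2 * s)^-1 * ev (curv_of k f s) (pd cT onshell_pexp)))); last first.
  by apply: filterS nreg => s /(along_d1E k h) ->.
rewrite -[derive1n 2 _ r]/(derive1 (derive1 _) r).
rewrite (@near_eq_derive1_at _ (derive1 (along (jet_d2 _) f)) (fun s =>
   m%:R * s ^+ m.-1 * (- 2^-1 * ev (curv_of k f s) (pd cA onshell_pexp))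
   + s ^+ m * (- 2^-1 * (
     ev (curv_of k f s) (pd cA (pd cA onshell_pexp)) * (- (derive1n 3 f s / 2))
     + ev (curv_of k f s) (pd cT (pd cA onshell_pexp))
       * ((curv_of k f s cA - curv_of k f s cT) / s)
     + ev (curv_of k f s) (pd cS (pd cA onshell_pexp))
       * (2 * (curv_of k f s cT - curv_of k f s cS) / s))))); last first.
  (* The second derivative at r requires the first derivative at all nearby points. *)
  have E : \forall s \near r, along (jet_d2 (fun r a b c => h r * on_shell_jet D k Z r a b c)) f s
      = h s * (- 2^-1 * ev (curv_of k f s) (pd cA onshell_pexp)).
    by apply: filterS nreg => s; exact: along_d2E.
  apply: filterS (filterI nreg (near_eq_derive1 E)) => s [regs ->].
  apply: is_derive1E; rewrite /h.
  have dA := is_derive_ev_curv k (pd cA onshell_pexp) regs.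
  by derive_with => //; rewrite /grad /dcurv_of /cvals; ring.
have dv i := is_derive_curv k i reg.
have dvA := dv cA; have dvT := dv cT; have dvS := dv cS.
have f3 : is_derive r (1 : R) (derive1n 3 f) (derive1n 4 f r).
  by case: reg => _ sf _; exact: (smooth_nearP 3 sf).
have dT := is_derive_ev_curv k (pd cT onshell_pexp) reg.
have dA := is_derive_ev_curv k (pd cA onshell_pexp) reg.
have dAA := is_derive_ev_curv k (pd cA (pd cA onshell_pexp)) reg.
have dTA := is_derive_ev_curv k (pd cT (pd cA onshell_pexp)) reg.
have dSA := is_derive_ev_curv k (pd cS (pd cA onshell_pexp)) reg.
have d2s : is_derive r (1 : R) ( *%R 2) 2.
  apply: is_derive_congr (is_derive_funM (is_derive_funC r 1 2) (is_derive_id r 1)) _.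
  by ring.
have dinv : is_derive r (1 : R) GRing.inv (- r ^- 2).
  by apply: is_derive_congr (is_derive_funV r0 (is_derive_id r 1)) _; rewrite mulr1.
have d2r : 2 * r != 0 by rewrite mulf_neq0.
rewrite [derive1 (fun s => s ^+ m * _) r](is_derive1E (a :=
  m%:R * r ^+ m.-1 * (- (2 * r)^-1 * ev (curv_of k f r) (pd cT onshell_pexp))
  + r ^+ m * ((2 * r ^+ 2)^-1 * ev (curv_of k f r) (pd cT onshell_pexp)
     - (2 * r)^-1 * grad (curv_of k f r) (dcurv_of k f r) (pd cT onshell_pexp)))); last first.
  derive_with => /=; first done.
  by field.
have eA : - (derive1n 3 f r / 2) = dcurv_of k f r cA by [].
have eT : (curv_of k f r cA - curv_of k f r cT) / r = dcurv_of k f r cT by [].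
have eS : 2 * (curv_of k f r cT - curv_of k f r cS) / r = dcurv_of k f r cS by [].
have gA : grad (curv_of k f r) (dcurv_of k f r) (pd cA onshell_pexp) =
   ev (curv_of k f r) (pd cA (pd cA onshell_pexp)) * dcurv_of k f r cA
   + ev (curv_of k f r) (pd cT (pd cA onshell_pexp)) * dcurv_of k f r cT
   + ev (curv_of k f r) (pd cS (pd cA onshell_pexp)) * dcurv_of k f r cS.
  have eR : dcurv_of k f r cR = 0 by [].
  by rewrite /grad eR mulr0 addr0.
have dd : is_derive r (1 : R) (fun s : R =>
  m%:R * s ^+ m.-1 * (- 2^-1 * ev (curv_of k f s) (pd cA onshell_pexp))
   + s ^+ m * (- 2^-1 * (
     ev (curv_of k f s) (pd cA (pd cA onshell_pexp)) * (- (derive1n 3 f s / 2))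
     + ev (curv_of k f s) (pd cT (pd cA onshell_pexp))
       * ((curv_of k f s cA - curv_of k f s cT) / s)
     + ev (curv_of k f s) (pd cS (pd cA onshell_pexp))
       * (2 * (curv_of k f s cT - curv_of k f s cS) / s)))) (
  let v := curv_of k f r in let dv := dcurv_of k f r in
  let QA i := pd i (pd cA onshell_pexp) in
  m%:R * (m.-1%:R * r ^+ m.-2) * (- 2^-1 * ev v (pd cA onshell_pexp))
     - m%:R * r ^+ m.-1 * grad v dv (pd cA onshell_pexp)
     - 2^-1 * r ^+ m *
      (grad v dv (QA cA) * dv cA + ev v (QA cA) * (- (derive1n 4 f r / 2))
       + grad v dv (QA cT) * ((v cA - v cT) / r)
       + ev v (QA cT) * ((dv cA - dv cT) / r - (v cA - v cT) / r ^+ 2)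
       + grad v dv (QA cS) * (2 * (v cT - v cS) / r)
       + ev v (QA cS) * (2 * (dv cT - dv cS) / r - 2 * (v cT - v cS) / r ^+ 2))).
  derive_with => //.
  cbv zeta beta; rewrite gA -eA -eT -eS.
  generalize (derive1n 3 f r) (derive1n 4 f r) (curv_of k f r cA) (curv_of k f r cT)
    (curv_of k f r cS).
  clear -r0; move: (ev _ _) (ev _ _) (ev _ _) (ev _ _) (grad _ _ _) (grad _ _ _) (grad _ _ _).
  move=> *; by field.
rewrite (is_derive1E dd); reflexivity.
Qed.

End OnShell.

(** * The on-shell form *)

(** Continuity at x. It recovers psi = 0, where [homog_scale] would divide by zero. *)
Lemma eq_at_of_punctured (R : realType) (f g : R -> R) (x a b : R) :
  is_derive x (1 : R) f a -> is_derive x (1 : R) g b ->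
  (forall y, y != x -> f y = g y) -> f x = g x.
Proof.
move=> df dg fg; have dh := is_derive_funB df dg.
have ch : {for x, continuous (fun y => f y - g y)}.
  by apply/differentiable_continuous/derivable1_diffP; case: dh.
have l1 : f y - g y @[y --> x^'] --> f x - g x by exact/continuous_withinNx.
have l0 : f y - g y @[y --> x^'] --> (0 : R).
  have : (0 : R) @[_ --> x^'] --> (0 : R) by exact: cvg_cst.
  apply: cvg_trans; apply: near_eq_cvg.
  by apply: filterS (nbhs_dnbhs_neq x) => y /fg ->; rewrite subrr.
by apply/eqP; rewrite -subr_eq0; apply/eqP; exact: (norm_cvg_unique l1 l0).
Qed.

Lemma homog_scale (R : realType) (e : pexp R) (n : nat) (A B S : R) :
  homog n e -> S != 0 ->
  ev (cvals A B 0 S) e = S ^+ n * ev (cvals (A / S) (B / S) 0 1) e.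
Proof.
move=> he S0; rewrite -he; apply: eq_ev => -[] /=; by field.
Qed.

Lemma is_derive_psi_ev (R : realType) (e : pexp R) (A B S : R) :
  is_derive S (1 : R) (fun s => ev (cvals A B 0 s) e) (ev (cvals A B 0 S) (pd cS e)).
Proof.
apply: is_derive_congr (is_derive_ev (u := fun s => cvals A B 0 s)
  (du := cvals 0 0 0 1) e _) _.
  by case; rewrite /cvals; first [exact: is_derive_funC | exact: is_derive_id].
by rewrite /grad /=; ring.
Qed.

(** This is c r^(2-D) d/dr { r^(D-1) [ (2n-D) S^n - 2n S^(n-1) B ] } expanded with r S' = 2 (B - S)
    and r B' = A - B. *)
Definition qt_form (R : realType) (D n : nat) (c A B S : R) : R :=
  c * (((2 * n)%:R - D%:R) * (D%:R - 1 - (2 * n)%:R) * S ^+ n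
       + 4 * n%:R * ((2 * n)%:R - D%:R) * S ^+ (n - 1) * B
       - (2 * n)%:R * A * S ^+ (n - 1)
       - 4 * n%:R * (n%:R - 1) * S ^+ (n - 2) * B ^+ 2).

Section OnShellForm.
Variables (R : realType) (D n : nat) (Z : density R n).
Hypotheses (D_ge5 : (5 <= D)%N) (n_gt0 : (0 < n)%N).
Let D_gt1 : (1 < D)%N := leq_trans (isT : (2 <= 5)%N) D_ge5.
Let Q : pexp R := onshell_pexp D Z.

Lemma homog_onshell : homog n Q.
Proof.
move=> l u; rewrite /Q /onshell_pexp !ev_psub.
exact: (@homog_density_pexp R D n Z l (fun v => u (merge v))).
Qed.

(** Differentiate Euler's identity for e in direction i at t = 0 and use the symmetry of second
    derivatives. *)
Lemma euler_homog2 (e : pexp R) (u : cvar -> R) i : homog n e ->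
  grad u u (pd i e) = (n%:R - 1) * ev u (pd i e).
Proof.
move=> he; pose w t v : R := u v + t * (cvar_eqb i v)%:R.
have w0 : w 0 = u by apply/funext => v; rewrite /w mul0r addr0.
have dw v : is_derive (0 : R) (1 : R) (fun t => w t v) (cvar_eqb i v)%:R.
  apply: is_derive_congr (is_derive_funD (is_derive_funC _ _ _)
    (is_derive_funM (is_derive_id _ _) (is_derive_funC _ _ _))) _; ring.
have de e' := is_derive_ev (u := w) e' dw.
have d1 : is_derive (0 : R) (1 : R) (fun t => grad (w t) (w t) e) (n%:R * ev u (pd i e)).
  under eq_fun do rewrite (euler_homog _ he).
  apply: is_derive_congr (is_derive_funM (is_derive_funC _ _ _) (de e)) _.
  by rewrite w0 /grad /=; case: (i) => /=; ring.
have d2 := is_derive_funD (is_derive_funD (is_derive_funD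
  (is_derive_funM (de (pd cA e)) (dw cA)) (is_derive_funM (de (pd cT e)) (dw cT)))
  (is_derive_funM (de (pd cR e)) (dw cR))) (is_derive_funM (de (pd cS e)) (dw cS)).
have := is_derive_unique d1 d2; rewrite w0 mulrBl => ->.
rewrite /grad; case: (i) => /=; rewrite ![ev u (pd cA (pd cT e))]ev_pdC;
rewrite ![ev u (pd cA (pd cR e))]ev_pdC ![ev u (pd cA (pd cS e))]ev_pdC
  ![ev u (pd cT (pd cR e))]ev_pdC ![ev u (pd cT (pd cS e))]ev_pdC
  ![ev u (pd cR (pd cS e))]ev_pdC; ring.
Qed.

Variable k : R.
Hypotheses (hk : horizon_curvature k) (hZ : quasi_topological D k Z).

Let pt (A B : R) : cvar -> R := cvals A B 0 1.

(* At r = 2 the value psi = 1 means f = k - 4, which vanishes for no horizon. *)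
Lemma exists_test_function (A B x y : R) : exists f, [/\ regular_at f 2,
  curv_of k f 2 = pt A B, dcurv_of k f 2 = cvals x ((A - B) / 2) 0 (B - 1)
  & derive1n 4 f 2 = y].
Proof.
have [p [p0 p1 p2 p3 p4]] :=
  exists_jet (2 : R) (k - 4) (- 4 * B) (- 2 * A) (- 2 * x) y.
have cE : curv_of k (horner p) 2 = pt A B.
  rewrite /curv_of p0 p1 p2 /curv /pt; apply/funext => -[] /=; by field.
exists (horner p); split => //.
- split => //; first exact: smooth_near_horner.
  rewrite p0; case: hk => ->; rewrite subr_eq0 eq_sym -subr_eq0.
  + by rewrite (_ : 4 - 1 = 3%:R :> R) ?pnatr_eq0 //; ring.
  + by rewrite (_ : 4 - 0 = 4%:R :> R) ?pnatr_eq0 //; ring.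
  + by rewrite (_ : 4 - -1 = 5%:R :> R) ?pnatr_eq0 //; ring.
- rewrite /dcurv_of cE p3 /pt; apply/funext => -[] /=; by field.
Qed.

Lemma qt_at (A B x : R) : qt_value D Z 2 (pt A B) (cvals x ((A - B) / 2) 0 (B - 1)) = 0.
Proof.
have [f [reg fc fd _]] := exists_test_function A B x 0.
by rewrite -fc -fd; exact: quasi_topological_eq.
Qed.

Lemma el_at (A B x y : R) :
  el_value D Z 2 (pt A B) (cvals x ((A - B) / 2) 0 (B - 1)) y = 0.
Proof.
have [f [reg fc fd <-]] := exists_test_function A B x y.
by rewrite -fc -fd -euler_lagrangeE //; case: hZ => + _; exact.
Qed.

Let q i A B : R := ev (pt A B) (pd i Q).
Let q2 i j A B : R := ev (pt A B) (pd i (pd j Q)).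

Lemma q2AA A B : q2 cA cA A B = 0.
Proof.
(* At r = 2 the fourth derivative y contributes 2^(D-2) y / 4 times Q_AA; this y makes the factor
   1. *)
have := el_at A B 0 0; have := el_at A B 0 (4 / 2 ^+ (D - 2)).
rewrite /el_value /= => e1 e2; have := congr2 (fun a b => a - b) e1 e2.
rewrite subr0 => <-; rewrite /q2 -/Q.
by field; rewrite expf_neq0.
Qed.

Lemma q2TA A B : q2 cT cA A B = 0.
Proof.
(* The derivative x of A contributes x (4 Q_AA + 2 Q_AB), and Q_AA is already zero. *)
have := qt_at A B 0; have := qt_at A B 1.
rewrite /qt_value /grad /= -/Q => e1 e2; have := congr2 (fun a b => a - b) e1 e2.
have := q2AA A B; rewrite /q2 subr0 (ev_pdC _ cA cT) => hAA.
rewrite hAA => h; apply: (mulfI (x := 2)) => //; rewrite mulr0 -[RHS]h; ring.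
Qed.

Lemma is_derive_q (V : normedModType R) (x v : V) (e : pexp R) (a b : V -> R) a' b' :
  is_derive x v a a' -> is_derive x v b b' ->
  is_derive x v (fun y => ev (pt (a y) (b y)) e)
    (ev (pt (a x) (b x)) (pd cA e) * a' + ev (pt (a x) (b x)) (pd cT e) * b').
Proof.
move=> da db; apply: is_derive_congr (is_derive_ev (u := fun y => pt (a y) (b y))
  (du := cvals a' b' 0 0) e _) _.
  by case; rewrite /pt /cvals => //; exact: is_derive_funC.
by rewrite /grad /=; ring.
Qed.

Lemma is_derive_qA A B e :
  is_derive A (1 : R) (fun a => ev (pt a B) e) (ev (pt A B) (pd cA e)).
Proof.
apply: is_derive_congr (is_derive_q e (is_derive_id A 1) (is_derive_funC A 1 B)) _; ring.
Qed.

Lemma is_derive_qT A B e :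
  is_derive B (1 : R) (fun b => ev (pt A b) e) (ev (pt A B) (pd cT e)).
Proof.
apply: is_derive_congr (is_derive_q e (is_derive_funC B 1 A) (is_derive_id B 1)) _; ring.
Qed.

(** The aim is Q(A, B, 1) = ah + be A + u B + 2 (n - 1) be B^2, with two linear relations between
    ah, u and be. *)
Let be : R := q cA 0 0.
Let u : R := q cT 0 0.
Let ah : R := ev (pt 0 0) Q.

Lemma qA A B : q cA A B = be.
Proof.
transitivity (q cA 0 B).
  apply: (is_derive_0_is_cst (f := fun a => q cA a B)) => a.
  by apply: is_derive_congr (is_derive_qA a B _) _; exact: q2AA.
apply: (is_derive_0_is_cst (f := fun b => q cA 0 b)) => b.
by apply: is_derive_congr (is_derive_qT 0 b _) _; exact: q2TA.
Qed.

Lemma ev_linear_A A B : ev (pt A B) Q = be * A + ev (pt 0 B) Q.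
Proof.
have h : ev (pt A B) Q - be * A = ev (pt 0 B) Q - be * 0.
  apply: (is_derive_0_is_cst (f := fun a => ev (pt a B) Q - be * a)) => a.
  apply: is_derive_congr (is_derive_funB (is_derive_qA a B Q)
    (is_derive_funM (is_derive_funC a 1 be) (is_derive_id a 1))) _.
  by have := qA a B; rewrite /q => ->; ring.
by rewrite mulr0 subr0 in h; rewrite -h; ring.
Qed.

Lemma qT_indep A B : q cT A B = q cT 0 B.
Proof.
apply: (is_derive_0_is_cst (f := fun a => q cT a B)) => a.
apply: is_derive_congr (is_derive_qA a B _) _.
by rewrite ev_pdC; exact: q2TA.
Qed.

Lemma qTT_indep A B : q2 cT cT A B = q2 cT cT 0 B.
Proof.
apply: is_derive_unique (is_derive_qT A B (pd cT Q)) _.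
rewrite (_ : (fun b => _) = (fun b => ev (pt 0 b) (pd cT Q))); first exact: is_derive_qT.
by apply/funext => b; exact: qT_indep.
Qed.

(** Euler's identity at psi = 1 trades the derivative in psi for derivatives in A and B, which makes
    the quasi-topological condition an equation in A and B alone. *)
Lemma qS A B : q cS A B = n%:R * ev (pt A B) Q - A * be - B * q cT 0 B.
Proof.
have := euler_homog (pt A B) homog_onshell; rewrite /grad /= -/Q => <-.
by rewrite -[ev _ (pd cA Q)]/(q cA A B) -[ev _ (pd cT Q)]/(q cT A B) qA qT_indep /q; ring.
Qed.

Lemma q2SA A B : q2 cS cA A B = (n%:R - 1) * be.
Proof.
have := euler_homog2 (pt A B) cA homog_onshell; rewrite /grad /=.
rewrite -[ev _ (pd cA Q)]/(q cA A B) qA => <-.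
by rewrite -[ev _ (pd cA (pd cA Q))]/(q2 cA cA A B)
  -[ev _ (pd cT (pd cA Q))]/(q2 cT cA A B) q2AA q2TA /q2; ring.
Qed.

Lemma q2ST A B : q2 cS cT A B = (n%:R - 1) * q cT 0 B - B * q2 cT cT 0 B.
Proof.
have := euler_homog2 (pt A B) cT homog_onshell; rewrite /grad /=.
rewrite -[ev _ (pd cT Q)]/(q cT A B) qT_indep => <-.
rewrite (ev_pdC _ cA cT) -[ev _ (pd cT (pd cA Q))]/(q2 cT cA A B)
  -[ev _ (pd cT (pd cT Q))]/(q2 cT cT A B) q2TA qTT_indep /q2; ring.
Qed.

Lemma qt_reduced A B :
  2 * (D%:R - 2) * be + 4 * ((n%:R - 1) * be * (B - 1)) + (D%:R - 4) * q cT 0 B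
  + 2 * (q2 cT cT 0 B * ((A - B) / 2)
         + ((n%:R - 1) * q cT 0 B - B * q2 cT cT 0 B) * (B - 1))
  - 4 * (n%:R * (be * A + ev (pt 0 B) Q) - A * be - B * q cT 0 B) = 0.
Proof.
have := qt_at A B 0; rewrite /qt_value /grad /= -/Q (ev_pdC _ cA cT).
rewrite -[ev _ (pd cA Q)]/(q cA A B) -[ev _ (pd cT Q)]/(q cT A B) -[ev _ (pd cS Q)]/(q cS A B).
rewrite -[ev _ (pd cT (pd cA Q))]/(q2 cT cA A B) -[ev _ (pd cS (pd cA Q))]/(q2 cS cA A B).
rewrite -[ev _ (pd cT (pd cT Q))]/(q2 cT cT A B) -[ev _ (pd cS (pd cT Q))]/(q2 cS cT A B).
rewrite qA qS ev_linear_A qT_indep q2TA q2SA q2ST qTT_indep => h; rewrite -[RHS]h; ring.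
Qed.

(** [qt_reduced] is affine in A and holds for every A; this is its coefficient of A. *)
Lemma qTT_cst B : q2 cT cT 0 B = 4 * (n%:R - 1) * be.
Proof.
have e1 := qt_reduced 1 B; have e0 := qt_reduced 0 B.
have := congr2 (fun a b => a - b) e1 e0; rewrite subr0 => h.
by apply/eqP; rewrite -subr_eq0; apply/eqP; rewrite -[RHS]h; field.
Qed.

Lemma qT_affine B : q cT 0 B = u + 4 * (n%:R - 1) * be * B.
Proof.
have h : q cT 0 B - 4 * (n%:R - 1) * be * B = q cT 0 0 - 4 * (n%:R - 1) * be * 0.
  apply: (is_derive_0_is_cst (f := fun b => q cT 0 b - 4 * (n%:R - 1) * be * b)) => b.
  apply: is_derive_congr (is_derive_funB (is_derive_qT 0 b (pd cT Q))
    (is_derive_funM (is_derive_funC b 1 _) (is_derive_id b 1))) _.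
  by have := qTT_cst b; rewrite /q2 => ->; ring.
by rewrite mulr0 subr0 -/u in h; rewrite -h; ring.
Qed.

Lemma ev_quadratic B : ev (pt 0 B) Q = ah + u * B + 2 * (n%:R - 1) * be * B ^+ 2.
Proof.
pose g b := u * b + 2 * (n%:R - 1) * be * b ^+ 2.
have h : ev (pt 0 B) Q - g B = ev (pt 0 0) Q - g 0.
  apply: (is_derive_0_is_cst (f := fun b => ev (pt 0 b) Q - g b)) => b.
  apply: is_derive_congr (is_derive_funB (is_derive_qT 0 b Q) (is_derive_funD
    (is_derive_funM (is_derive_funC b 1 u) (is_derive_id b 1))
    (is_derive_funM (is_derive_funC b 1 _) (is_derive_funX 2 (is_derive_id b 1))))) _.
  by have := qT_affine b; rewrite /q => -> /=; ring.
rewrite (_ : g 0 = 0) ?subr0 -/ah in h; last by rewrite /g; ring.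
by rewrite -h /g; ring.
Qed.

Lemma coeff_relations :
  u = 2 * (D%:R - 2 * n%:R) * be /\
  2 * n%:R * ah = (D%:R - 2 * n%:R) * (D%:R - 1 - 2 * n%:R) * be.
Proof.
have h0 := qt_reduced 0 0; have h1 := qt_reduced 0 1.
rewrite !qTT_cst !qT_affine !ev_quadratic in h0 h1.
(* With A = B = psi = 1 the curvatures have zero radial derivative at r = 2, so only first partial
   derivatives of Q survive in the Euler-Lagrange equation. *)
have hE : - q cS 1 1 + (D%:R - 3) / 2 * q cT 0 1 - (D%:R - 2) * (D%:R - 3) / 2 * be = 0.
  have := el_at 1 1 0 0; rewrite /el_value.
  have gr e : grad (pt 1 1) (cvals 0 ((1 - 1) / 2) 0 (1 - 1)) e = 0.
    by rewrite /grad /=; ring.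
  rewrite !gr -/Q.
  (* Makes the truncated exponents [m.-1] and [m.-2] genuine differences. *)
  have [d Dd] : exists d, D = (d + 5)%N by exists (D - 5)%N; rewrite subnK.
  have -> : (D - 2)%N = d.+3 by rewrite Dd; lia.
  have -> : D%:R = d%:R + 5 :> R by rewrite Dd natrD.
  rewrite /=.
  rewrite -[ev _ (pd cS Q)]/(q cS 1 1) -[ev _ (pd cT Q)]/(q cT 1 1)
    -[ev _ (pd cA Q)]/(q cA 1 1) qA qT_indep => h.
  have p2 : 2 ^+ d != 0 :> R by rewrite expf_neq0.
  apply: (mulfI p2); apply: (mulfI (x := 2)) => //; rewrite !mulr0 -[RHS]h.
  by rewrite !exprS -!natr1; field.
rewrite qS qT_affine ev_linear_A ev_quadratic in hE.
(* Comparing B = 0 with B = 1 determines u except for n = 1. *)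
have hu : (n%:R - 1) * (u - 2 * (D%:R - 2 * n%:R) * be) = 0.
  have := congr2 (fun a b => a - b) h1 h0; rewrite subr0 => h.
  apply: (mulfI (x := - 2)); first by rewrite oppr_eq0.
  by rewrite mulr0 -[RHS]h; field.
have uE : u = 2 * (D%:R - 2 * n%:R) * be.
  move: hu => /eqP; rewrite mulf_eq0 => /orP[|]; last by rewrite subr_eq0 => /eqP.
  rewrite subr_eq0 => /eqP n1; rewrite n1 in h0 hE *.
  have D2 : D%:R - 2 != 0 :> R.
    by rewrite subr_eq0 (eqr_nat _ D 2) gtn_eqF // (leq_trans _ D_ge5).
  apply: (mulfI D2); apply/eqP; rewrite -subr_eq0; apply/eqP.
  have z : 4 * 0 - 0 = 0 :> R by ring.
  (* For n = 1 this combination eliminates ah and leaves (D - 2) (u - 2 (D - 2) be) = 0. *)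
  have h := etrans (congr2 (fun a b => 4 * a - b) hE h0) z.
  by rewrite -[RHS]h /=; field.
split=> //; rewrite uE in h0.
apply/eqP; rewrite -subr_eq0; apply/eqP.
apply: (mulfI (x := - 2)); first by rewrite oppr_eq0.
by rewrite mulr0 -[RHS]h0; field.
Qed.

Lemma onshell_pexp_form : exists c, forall A B S,
  ev (cvals A B 0 S) Q = qt_form D n c A B S.
Proof.
have n0 : n%:R != 0 :> R by rewrite pnatr_eq0 -lt0n.
have [uE ahE] := coeff_relations.
(* Chosen so that the coefficient of A in [qt_form] at psi = 1, namely - 2 n c, equals be. *)
pose c := - be / (2 * n%:R); exists c.
have at1 A B : ev (cvals A B 0 1) Q = qt_form D n c A B 1.
  rewrite [LHS]ev_linear_A ev_quadratic uE.
  have -> : ah = (D%:R - 2 * n%:R) * (D%:R - 1 - 2 * n%:R) * be / (2 * n%:R).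
    by rewrite -ahE; field.
  by rewrite /qt_form !expr1n natrM /c; field.
have punct A B S : S != 0 -> ev (cvals A B 0 S) Q = qt_form D n c A B S.
  move=> S0; rewrite (homog_scale _ _ homog_onshell S0) at1 /qt_form !expr1n.
  (* For n = 1 the exponent n - 2 is truncated to 0, but its coefficient contains the factor n - 1 =
     0. *)
  case: n n_gt0 => [//|[|m]] _.
    by rewrite !subnn !expr0 expr1 /=; field.
  rewrite subn1 subn2 /= !exprS; by field.
move=> A B S; have [->|S0] := eqVneq S 0; last exact: punct.
have dm (a : R) p := is_derive_funM (is_derive_funC (0 : R) 1 a)
  (is_derive_funX p (is_derive_id (0 : R) 1)).
have E : (fun s => qt_form D n c A B s) = (fun s =>
    c * (((2 * n)%:R - D%:R) * (D%:R - 1 - (2 * n)%:R)) * s ^+ n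
    + (c * (4 * n%:R * ((2 * n)%:R - D%:R) * B - (2 * n)%:R * A) * s ^+ (n - 1)
    + (- c * (4 * n%:R * (n%:R - 1) * B ^+ 2)) * s ^+ (n - 2))).
  by apply/funext => s; rewrite /qt_form; ring.
have [b dF] : exists b, is_derive (0 : R) (1 : R) (fun s => qt_form D n c A B s) b.
  rewrite E; eexists.
  exact: is_derive_funD (dm _ n) (is_derive_funD (dm _ (n - 1)%N) (dm _ (n - 2)%N)).
exact: eq_at_of_punctured (is_derive_psi_ev Q A B 0) dF (punct A B).
Qed.

End OnShellForm.

(** * The integrated equation *)

Definition alpha_qt (R : realType) (D n : nat) (c : R) (j : 'I_n.+1) : R :=
  match nat_of_ord j with
  | 0 => c * ((2 * n)%:R - D%:R)
  | 1 => - c * (2 * n)%:R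
  | _ => 0
  end.

Section TotalDerivative.
Variables (R : realType) (D n : nat) (k : R).
Hypotheses (D_ge5 : (5 <= D)%N) (n_gt0 : (0 < n)%N).
Implicit Types (f : R -> R) (r c : R).

Definition qt_potential f r : R :=
  r ^+ (D - 1) * (((2 * n)%:R - D%:R) * psi k f r ^+ n
                  - (2 * n)%:R * psi k f r ^+ (n - 1) * calB f r).

Lemma T0_of_alpha_qt c f r : T0_of D k (@alpha_qt R D n c) f r = c * qt_potential f r.
Proof.
rewrite /T0_of /qt_potential; case: n n_gt0 => // m _.
rewrite big_ord_recl big_ord_recl /= big1 => [|j _]; last by rewrite /alpha_qt !lift0 /= !mul0r.
by rewrite /alpha_qt !lift0 /= expr0 expr1 subn0; ring.
Qed.

Lemma is_derive_psi f r : regular_at f r ->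
  is_derive r (1 : R) (psi k f) (2 * (calB f r - psi k f r) / r).
Proof. by move=> reg; have := is_derive_curv k cS reg. Qed.

Lemma is_derive_calB f r : regular_at f r ->
  is_derive r (1 : R) (calB f) ((curv_of k f r cA - calB f r) / r).
Proof. by move=> reg; have := is_derive_curv k cT reg. Qed.

Lemma is_derive_qt_potential f r : regular_at f r ->
  is_derive r (1 : R) (qt_potential f)
    (r ^+ (D - 2) * qt_form D n 1 (curv_of k f r cA) (calB f r) (psi k f r)).
Proof.
move=> reg; have dS := is_derive_psi reg; have dB := is_derive_calB reg.
have r0 : r != 0 by case: reg => /lt0r_neq0.
apply: is_derive_congr (is_derive_funM (is_derive_funX (D - 1) (is_derive_id r 1))
  (is_derive_funB (is_derive_funM (is_derive_funC r 1 ((2 * n)%:R - D%:R))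
     (is_derive_funX n dS))
   (is_derive_funM (is_derive_funM (is_derive_funC r 1 (2 * n)%:R)
     (is_derive_funX (n - 1) dS)) dB))) _.
move: (psi k f r) (calB f r) (curv_of k f r cA) => S B A.
have [d ->] : exists d, D = (d + 5)%N by exists (D - 5)%N; rewrite subnK.
have -> : (d + 5 - 1)%N = d.+4 by lia.
have -> : (d + 5 - 2)%N = d.+3 by lia.
rewrite /qt_form natrM natrD -[d.+4%:R]natr1 -[d.+3%:R]natr1 -[d.+2%:R]natr1 -[d.+1%:R]natr1.
case: n n_gt0 => [//|[|m]] _.
  by rewrite !subnn expr0 expr1 /= !exprS; field.
by rewrite subn1 subn2 /= -[m.+2%:R]natr1 -[m.+1%:R]natr1 !exprS; field.
Qed.

End TotalDerivative.

(** * First-order expansion in N' and N'' *)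

Section Integrated.
Variables (R : realType) (D n : nat) (Z : density R n) (c : R).
Hypotheses (D_ge5 : (5 <= D)%N) (n_gt0 : (0 < n)%N).
Hypothesis formQ : forall A B S,
  ev (cvals A B 0 S) (onshell_pexp D Z) = qt_form D n c A B S.
Let D_gt1 : (1 < D)%N := leq_trans (isT : (2 <= 5)%N) D_ge5.
Let P : pexp R := density_pexp D Z.
Implicit Types (k r : R) (f N : R -> R).

Lemma on_shell_qt k f (x : 'rV[R]_D) : in_chart k x -> regular_at f (radial_coord x) ->
  on_shell k Z f x = c / radial_coord x ^+ (D - 2) *
    derive1 (qt_potential D n k f) (radial_coord x).
Proof.
move=> cx reg; rewrite (is_derive1E (is_derive_qt_potential k D_ge5 n_gt0 reg)).
rewrite (on_shellE Z D_gt1 cx reg) /curv_of /curv formQ /cvals -/(calB f _) -/(psi k f _).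
have r0 : radial_coord x ^+ (D - 2) != 0 by rewrite expf_neq0 //; case: reg => /lt0r_neq0.
by rewrite /qt_form; field.
Qed.

Lemma ev_density_diag A B S : ev (cvals A B B S) P = qt_form D n c A B S.
Proof. by rewrite -formQ ev_psub; apply: eq_ev => -[]. Qed.

Definition qt_dA S : R := - c * (2 * n)%:R * S ^+ (n - 1).
Definition qt_dT B S : R :=
  c * (2 * n%:R * ((2 * n)%:R - D%:R) * S ^+ (n - 1)
       - 4 * n%:R * (n%:R - 1) * S ^+ (n - 2) * B).

Lemma ev_pdA A B S : ev (cvals A B B S) (pd cA P) = qt_dA S.
Proof.
have d1 : is_derive A (1 : R) (fun a => ev (cvals a B B S) P) (ev (cvals A B B S) (pd cA P)).
  apply: is_derive_congr (is_derive_ev (u := fun a => cvals a B B S)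
    (du := cvals 1 0 0 0) P _) _.
    by case; rewrite /cvals; first [exact: is_derive_funC | exact: is_derive_id].
  by rewrite /grad /=; ring.
apply: (is_derive_unique d1); under eq_fun do rewrite ev_density_diag /qt_form.
rewrite (_ : (fun a => _) = fun a => qt_form D n c 0 B S + qt_dA S * a); last first.
  by apply/funext => a; rewrite /qt_form /qt_dA; ring.
apply: is_derive_congr (is_derive_funD (is_derive_funC A 1 _)
  (is_derive_funM (is_derive_funC A 1 _) (is_derive_id A 1))) _; ring.
Qed.

Lemma ev_pdT_pdR A B S : ev (cvals A B B S) (pd cT P) = ev (cvals A B B S) (pd cR P).
Proof.
have d1 : is_derive B (1 : R) (fun b => ev (cvals A b B S) P) (ev (cvals A B B S) (pd cT P)).
  apply: is_derive_congr (is_derive_ev (u := fun b => cvals A b B S)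
    (du := cvals 0 1 0 0) P _) _.
    by case; rewrite /cvals; first [exact: is_derive_funC | exact: is_derive_id].
  by rewrite /grad /=; ring.
apply: (is_derive_unique d1).
rewrite (_ : (fun b => _) = fun b => ev (cvals A B b S) P); last first.
  apply/funext => b; rewrite -[RHS](ev_density_swap D_gt1 Z); apply: eq_ev; by case.
apply: is_derive_congr (is_derive_ev (u := fun b => cvals A B b S)
    (du := cvals 0 0 1 0) P _) _.
  by case; rewrite /cvals; first [exact: is_derive_funC | exact: is_derive_id].
by rewrite /grad /=; ring.
Qed.

Lemma ev_pdT A B S : ev (cvals A B B S) (pd cT P) = qt_dT B S.
Proof.
have d1 : is_derive B (1 : R) (fun b => ev (cvals A b b S) P)
    (2 * ev (cvals A B B S) (pd cT P)).
  apply: is_derive_congr (is_derive_ev (u := fun b => cvals A b b S)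
    (du := cvals 0 1 1 0) P _) _.
    by case; rewrite /cvals; first [exact: is_derive_funC | exact: is_derive_id].
  by rewrite /grad /= -ev_pdT_pdR; ring.
apply: (mulfI (x := 2)) => //; apply: (is_derive_unique d1).
under eq_fun do rewrite ev_density_diag.
rewrite (_ : (fun b => _) = fun b => qt_form D n c A 0 S
   + (c * (4 * n%:R * ((2 * n)%:R - D%:R) * S ^+ (n - 1)) * b
      + - c * (4 * n%:R * (n%:R - 1) * S ^+ (n - 2)) * b ^+ 2)); last first.
  by apply/funext => b; rewrite /qt_form; ring.
apply: is_derive_congr (is_derive_funD (is_derive_funC B 1 _)
  (is_derive_funD (is_derive_funM (is_derive_funC B 1 _) (is_derive_id B 1))
    (is_derive_funM (is_derive_funC B 1 _) (is_derive_funX 2 (is_derive_id B 1))))) _.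
by rewrite /qt_dT /=; ring.
Qed.

(** The chain rule for P: a unit of N'/N shifts A by - 3 f'/2 and B_t by - f/r, a unit of N''/N
    shifts A by - f. *)
Definition T1_qt k f r : R :=
  r ^+ (D - 2) * (- (3 / 2) * derive1 f r * qt_dA (psi k f r)
                  - f r / r * qt_dT (calB f r) (psi k f r)).
Definition T2_qt k f r : R := - (r ^+ (D - 2) * f r * qt_dA (psi k f r)).

Lemma N_expansion_qt k :
  N_expansion D k Z (T0_of D k (@alpha_qt R D n c)) (T1_qt k) (T2_qt k).
Proof.
move=> f r reg; have [r0 _ _] := reg; have rn := lt0r_neq0 r0.
pose u := cvals (curv_of k f r cA) (calB f r) (calB f r) (psi k f r).
pose v := cvals (- (3 / 2) * derive1 f r) (- (f r / r)) 0 0.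
pose w := cvals (- f r) 0 0 0.
have [C C0 hC] := ev_taylor2 P u v w.
(* With delta = 1 the ratios x and y stay in the range of [ev_taylor2]. The curvatures are exactly
   affine in them, so the whole remainder comes from P, and N (x^2 + y^2) = (N'^2 + N''^2) / N. *)
exists (r ^+ (D - 2) * C), 1; split => // N sN N0; rewrite !mul1r => h1 h2.
have Nn := lt0r_neq0 N0.
pose x := derive1 N r / N r; pose y := derive1n 2 N r / N r.
have x1 : `|x| <= 1 by rewrite /x normrM normfV ler_pdivrMr ?normr_gt0 // mul1r (gtr0_norm N0).
have y1 : `|y| <= 1 by rewrite /y normrM normfV ler_pdivrMr ?normr_gt0 // mul1r (gtr0_norm N0).
rewrite (radial_on_shell_NE Z D_gt1 k reg sN N0).
have -> : ev (sectional_at k N f r) (density_pexp D Z) =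
    ev (fun i => u i + x * v i + y * w i) P.
  apply: eq_ev => i; rewrite /sectional_at /sectional /u /v /w /x /y.
  rewrite /curv_of /curv /calB /psi.
  move: (derive1n 2 N r) (derive1n 2 f r) (derive1 N r) (derive1 f r) => N2 f2 N1 f1.
  by case: i => /=; field; rewrite ?Nn ?rn.
have -> : derive1 (T0_of D k (@alpha_qt R D n c) f) r = r ^+ (D - 2) * ev u P.
  rewrite (_ : T0_of _ _ _ f = fun s => c * qt_potential D n k f s); last first.
    by apply/funext => s; rewrite T0_of_alpha_qt.
  rewrite (is_derive1E (is_derive_funM (is_derive_funC _ _ _)
    (is_derive_qt_potential k D_ge5 n_gt0 reg))).
  by rewrite /u ev_density_diag /qt_form; ring.
have gv : grad u v P = - (3 / 2) * derive1 f r * qt_dA (psi k f r)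
    - f r / r * qt_dT (calB f r) (psi k f r).
  by rewrite /grad /u ev_pdA ev_pdT /v /cvals; ring.
have gw : grad u w P = - f r * qt_dA (psi k f r).
  by rewrite /grad /u ev_pdA /w /cvals; ring.
rewrite /T1_qt /T2_qt -gv (_ : - (r ^+ (D - 2) * f r * qt_dA _) = r ^+ (D - 2) * grad u w P);
  last by rewrite gw; ring.
have := hC x y x1 y1; set E := ev _ P => hE.
rewrite (_ : _ - _ = (N r * r ^+ (D - 2)) *
   (E - (ev u P + x * grad u v P + y * grad u w P))); last first.
  by rewrite /x /y; field.
have NR : 0 < N r * r ^+ (D - 2) by rewrite mulr_gt0 // exprn_gt0.
rewrite normrM (gtr0_norm NR).
apply: (le_trans (ler_wpM2l (ltW NR) hE)).
by rewrite le_eqVlt; apply/orP; left; apply/eqP; rewrite /x /y; field.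
Qed.

End Integrated.

Lemma eq0_of_quadratic_bound (R : realType) (b K d : R) : 0 < d ->
  (forall e, 0 < e -> e <= d -> `|e * b| <= K * e ^+ 2) -> b = 0.
Proof.
move=> d0 H; apply/eqP; apply: contraT => b0.
have nb : 0 < `|b| by rewrite normr_gt0.
have K1 : 0 < `|K| + 1 by rewrite ltr_wpDl.
(* Small enough that K e is at most half of |b|, while dividing the bound by e gives |b| <= K e. *)
pose e := Num.min d (`|b| / (2 * (`|K| + 1))).
have e0 : 0 < e by rewrite lt_min d0 divr_gt0 // mulr_gt0.
have ed : e <= d by rewrite ge_min lexx.
have eb : e * (2 * (`|K| + 1)) <= `|b|.
  by rewrite -ler_pdivlMr ?mulr_gt0 // ge_min lexx orbT.
have := H e e0 ed; rewrite normrM (gtr0_norm e0) expr2 mulrCA ler_pM2l //.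
move=> hb; have : `|b| <= e * (`|K| + 1).
  apply: (le_trans hb); rewrite mulrC ler_pM2l //.
  by apply: (le_trans (ler_norm K)); rewrite lerDl.
by move: eb; rewrite mulrCA => eb h; exfalso; lra.
Qed.

(** * Uniqueness of the expansion coefficients *)

Section Uniqueness.
Variables (R : realType) (D n : nat) (Z : density R n) (k : R).
Implicit Types (f N : R -> R) (r : R).

(** Polynomials N with N = 1, N' = x, N'' = y at r make the difference of the two expansions affine
    in (x, y) but bounded by a multiple of x^2 + y^2, so all its coefficients vanish. *)
Lemma N_expansion_unique (T0 T1 T2 S0 S1 S2 : (R -> R) -> R -> R) f r :
  N_expansion D k Z T0 T1 T2 -> N_expansion D k Z S0 S1 S2 -> regular_at f r ->
  [/\ derive1 (T0 f) r = derive1 (S0 f) r, T1 f r = S1 f r & T2 f r = S2 f r].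
Proof.
move=> ET ES reg.
have [C1 [d1 [d1_gt0 H1]]] := ET f r reg; have [C2 [d2 [d2_gt0 H2]]] := ES f r reg.
pose a := derive1 (T0 f) r - derive1 (S0 f) r.
pose b := T1 f r - S1 f r; pose c := T2 f r - S2 f r.
pose d := Num.min d1 d2; have d0 : 0 < d by rewrite lt_min d1_gt0.
have dd1 : d <= d1 by rewrite ge_min lexx.
have dd2 : d <= d2 by rewrite ge_min lexx orbT.
have key (x y : R) : `|x| <= d -> `|y| <= d ->
    `|a + x * b + y * c| <= (C1 + C2) * (x ^+ 2 + y ^+ 2).
  move=> xd yd; have [p [p0 p1 p2 _ _]] := exists_jet r 1 x y 0 0.
  have sp := smooth_near_horner p r.
  have := H1 (horner p) sp; have := H2 (horner p) sp; rewrite p0 p1 p2 !mulr1 !divr1.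
  set X := 1 * _ * _ => h2 h1.
  have {}h1 := h1 ltr01 (le_trans xd dd1) (le_trans yd dd1).
  have {}h2 := h2 ltr01 (le_trans xd dd2) (le_trans yd dd2).
  rewrite mulrDl; apply: le_trans (lerD h1 h2); rewrite [leRHS]addrC.
  apply: le_trans (ler_normB _ _).
  by rewrite le_eqVlt; apply/orP; left; apply/eqP; congr `|_|; rewrite /a /b /c; ring.
have a0 : a = 0.
  have := key 0 0; rewrite normr0 => /(_ (ltW d0) (ltW d0)).
  by rewrite !mul0r !addr0 expr0n /= addr0 mulr0 normr_le0 => /eqP.
have b0 : b = 0.
  apply: (@eq0_of_quadratic_bound R b (C1 + C2) d d0) => e e0 ed.
  have := key e 0; rewrite normr0 (gtr0_norm e0) => /(_ ed (ltW d0)).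
  by rewrite a0 mul0r add0r addr0 expr0n /= addr0.
have c0 : c = 0.
  apply: (@eq0_of_quadratic_bound R c (C1 + C2) d d0) => e e0 ed.
  have := key 0 e; rewrite normr0 (gtr0_norm e0) => /(_ (ltW d0) ed).
  by rewrite a0 mul0r !add0r expr0n /= add0r.
by split; apply/eqP; rewrite -subr_eq0; apply/eqP.
Qed.

Definition ppow (v : cvar) (m : nat) : pexp R :=
  pprod (index_enum 'I_m) predT (fun=> PV v).

Definition T0_pexp (alpha : 'I_n.+1 -> R) : pexp R :=
  psum (index_enum 'I_n.+1) predT (fun j =>
    PM (PC (alpha j)) (PM (ppow cS (n - j)) (ppow cT j))).

Lemma ev_T0_pexp u alpha :
  ev u (T0_pexp alpha) = \sum_(j < n.+1) alpha j * u cS ^+ (n - j) * u cT ^+ j.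
Proof.
rewrite ev_psum; apply: eq_bigr => j _ /=.
by rewrite !ev_pprod /= !prodr_const !card_ord mulrA.
Qed.

Lemma homog_T0_pexp alpha : homog n (T0_pexp alpha).
Proof.
move=> l u; rewrite !ev_T0_pexp mulr_sumr; apply: eq_bigr => j _.
have jn : (j <= n)%N by rewrite -ltnS.
have -> : l ^+ n = l ^+ (n - j) * l ^+ j by rewrite -exprD subnK.
by rewrite !exprMn; ring.
Qed.

Lemma T0_ofE alpha f r : T0_of D k alpha f r = r ^+ (D - 1) * ev (curv_of k f r) (T0_pexp alpha).
Proof. by rewrite ev_T0_pexp. Qed.

Lemma is_derive_T0 alpha f r : regular_at f r ->
  is_derive r (1 : R) (T0_of D k alpha f)
   ((D - 1)%:R * r ^+ (D - 1).-1 * ev (curv_of k f r) (T0_pexp alpha)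
    + r ^+ (D - 1) * grad (curv_of k f r) (dcurv_of k f r) (T0_pexp alpha)).
Proof.
move=> reg; rewrite (_ : T0_of D k alpha f = fun s =>
  s ^+ (D - 1) * ev (curv_of k f s) (T0_pexp alpha)); last first.
  by apply/funext => s; rewrite T0_ofE.
apply: is_derive_congr (is_derive_funM (is_derive_funX (D - 1) (is_derive_id r 1))
  (is_derive_ev_curv k (T0_pexp alpha) reg)) _; ring.
Qed.

Hypotheses (hk : horizon_curvature k) (D_gt1 : (1 < D)%N).

(** T_0 contains no A, so the A-dependence of T_0' comes from B' alone and forces the derivative in
    B to vanish. No additive constant survives, because of the factor r^(D-1). *)
Lemma T0_pexp_eq0 alpha :
  (forall f r, regular_at f r -> derive1 (T0_of D k alpha f) r = 0) ->
  forall A B S, ev (cvals A B 0 S) (T0_pexp alpha) = 0.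
Proof.
move=> H0; pose e := T0_pexp alpha.
have indep A A' B S : ev (cvals A B 0 S) e = ev (cvals A' B 0 S) e.
  by rewrite !ev_T0_pexp.
have indepT A A' B : ev (cvals A B 0 1) (pd cT e) = ev (cvals A' B 0 1) (pd cT e).
  apply: is_derive_unique (is_derive_qT A B e) _.
  rewrite (_ : (fun b => _) = fun b => ev (cvals A' b 0 1) e); first exact: is_derive_qT.
  by apply/funext => b; exact: indep.
have indepS A A' B : ev (cvals A B 0 1) (pd cS e) = ev (cvals A' B 0 1) (pd cS e).
  apply: is_derive_unique (is_derive_psi_ev e A B 1) _.
  rewrite (_ : (fun b => _) = fun b => ev (cvals A' B 0 b) e); first exact: is_derive_psi_ev.
  by apply/funext => b; exact: indep.
have eqn A B : (D - 1)%:R * 2 ^+ (D - 1).-1 * ev (cvals 0 B 0 1) e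
    + 2 ^+ (D - 1) * (ev (cvals 0 B 0 1) (pd cT e) * ((A - B) / 2)
                      + ev (cvals 0 B 0 1) (pd cS e) * (B - 1)) = 0.
  have [f [reg fc fd _]] := exists_test_function hk A B 0 0.
  rewrite -[RHS](H0 f 2 reg) (is_derive1E (is_derive_T0 alpha reg)) fc fd -/e /grad /cvals.
  by rewrite (indep 0 A B 1) (indepT 0 A B) (indepS 0 A B); ring.
have p2 m : 2 ^+ m != 0 :> R by rewrite expf_neq0.
have T_0 B : ev (cvals 0 B 0 1) (pd cT e) = 0.
  (* The two values of A give r B' = 2 and r B' = 0, that is B' = 1 and B' = 0 at r = 2. *)
  have := congr2 (fun a b => a - b) (eqn (B + 2) B) (eqn B B); rewrite subr0 => h.
  by apply: (mulfI (p2 (D - 1)%N)); rewrite mulr0 -[RHS]h; field.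
(* At A = B = psi = 1 both B' and psi' vanish and only (D - 1) r^(D-2) times the polynomial is
   left. *)
have e1 : ev (cvals 0 1 0 1) e = 0.
  have := eqn 1 1; rewrite !subrr mul0r !mulr0 addr0 mulr0 addr0 => /eqP.
  rewrite !mulf_eq0 (negbTE (p2 _)) orbF pnatr_eq0 => /orP[|/eqP //].
  by rewrite subn_eq0 leqNgt D_gt1.
have eB B : ev (cvals 0 B 0 1) e = 0.
  rewrite -[RHS]e1; apply: (is_derive_0_is_cst (f := fun b => ev (cvals 0 b 0 1) e)) => b.
  by apply: is_derive_congr (is_derive_qT 0 b e) _; exact: T_0.
move=> A B S; have punct s : s != 0 -> ev (cvals A B 0 s) e = 0.
  move=> s0; rewrite (homog_scale _ _ (homog_T0_pexp alpha) s0).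
  by rewrite -/e (indep _ 0) eB mulr0.
have [->|] := eqVneq S 0; last exact: punct.
exact: (@eq_at_of_punctured R (fun s => ev (cvals A B 0 s) e) (fun=> 0) 0 _ _
  (is_derive_psi_ev e A B 0) (is_derive_funC _ _ _) punct).
Qed.

(** T_0 is linear in its coefficients. The difference vanishes as a polynomial function, hence also
    where f is not regular. *)
Lemma T0_of_unique (alpha beta : 'I_n.+1 -> R) :
  (forall f r, regular_at f r ->
     derive1 (T0_of D k alpha f) r = derive1 (T0_of D k beta f) r) ->
  forall f r, T0_of D k alpha f r = T0_of D k beta f r.
Proof.
move=> H f r; pose d j := alpha j - beta j.
have dE f' r' : T0_of D k d f' r' = T0_of D k alpha f' r' - T0_of D k beta f' r'.
  rewrite /T0_of -mulrBr -sumrB; congr (_ * _); apply: eq_bigr => j _.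
  by rewrite /d !mulrBl.
have d0 f' r' : regular_at f' r' -> derive1 (T0_of D k d f') r' = 0.
  move=> reg; rewrite (_ : T0_of D k d f' = fun s =>
    T0_of D k alpha f' s - T0_of D k beta f' s); last by apply/funext => s; rewrite dE.
  have da := is_derive_T0 alpha reg; have db := is_derive_T0 beta reg.
  rewrite (is_derive1E (is_derive_funB da db)) -(is_derive1E da) -(is_derive1E db).
  by rewrite H // subrr.
apply/eqP; rewrite -subr_eq0 -dE T0_ofE; apply/eqP.
by rewrite /curv_of /curv T0_pexp_eq0 ?mulr0.
Qed.

End Uniqueness.

(** * Value of the integrated equation *)

Section IntegratedEquation.
Variables (R : realType) (D n : nat) (Z : density R n) (c k : R).
Hypotheses (D_ge5 : (5 <= D)%N) (n_gt0 : (0 < n)%N) (hk : horizon_curvature k).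
Hypothesis formQ : forall A B S,
  ev (cvals A B 0 S) (onshell_pexp D Z) = qt_form D n c A B S.
Implicit Types (f : R -> R) (r : R).

(** The combination - T_1 + T_2' equals 2 n c r^(D-1) psi^(n-1) B, which cancels the B-term of
    T_0. *)
Lemma integrated_value f r : regular_at f r ->
  c * qt_potential D n k f r - T1_qt D n c k f r + derive1 (T2_qt D n c k f) r =
  - c * ((D%:R - (2 * n)%:R) * r ^ (D%:Z - (2 * n)%:Z - 1) * (k - f r) ^+ n).
Proof.
move=> reg; have dS := is_derive_psi k reg.
have r0 : r != 0 by case: reg => /lt0r_neq0.
have df : is_derive r (1 : R) f (derive1 f r) by case: reg => _ sf _; exact: (smooth_nearP 0 sf).
have dT2 : derive1 (T2_qt D n c k f) r =
   c * (2 * n)%:R * ((D - 2)%:R * r ^+ (D - 2).-1 * (f r * psi k f r ^+ (n - 1))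
     + r ^+ (D - 2) * (derive1 f r * psi k f r ^+ (n - 1)
       + f r * ((n - 1)%:R * psi k f r ^+ (n - 1).-1 * (2 * (calB f r - psi k f r) / r)))).
  apply: is_derive1E.
  rewrite (_ : T2_qt D n c k f = fun s => c * (2 * n)%:R *
    (s ^+ (D - 2) * (f s * psi k f s ^+ (n - 1)))); last first.
    by apply/funext => s; rewrite /T2_qt /qt_dA; ring.
  apply: is_derive_congr (is_derive_funM (is_derive_funC r 1 _)
    (is_derive_funM (is_derive_funX (D - 2) (is_derive_id r 1))
      (is_derive_funM df (is_derive_funX (n - 1) dS)))) _; ring.
have kf : (k - f r) ^+ n = psi k f r ^+ n * (r ^+ 2) ^+ n.
  by rewrite -exprMn; congr (_ ^+ n); rewrite /psi; field.
(* The exponent D - 2n - 1 may be negative, hence the integer power. *)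
have rz : r ^ (D%:Z - (2 * n)%:Z - 1) = r ^+ (D - 1) / (r ^+ 2) ^+ n.
  have -> : D%:Z - (2 * n)%:Z - 1 = (D - 1)%N%:Z + - (2 * n)%N%:Z by lia.
  by rewrite expfzDr // -exprnP -exprM -exprnN.
have f1 : derive1 f r = - (2 * r) * calB f r by rewrite /calB; field.
rewrite rz kf dT2 /qt_potential /T1_qt /qt_dA /qt_dT f1.
move: (psi k f r) (calB f r) (f r) => S B f0.
have [d ->] : exists d, D = (d + 5)%N by exists (D - 5)%N; rewrite subnK.
have -> : (d + 5 - 1)%N = d.+4 by lia.
have -> : (d + 5 - 2)%N = d.+3 by lia.
rewrite natrM natrD -[d.+3%:R]natr1 -[d.+2%:R]natr1 -[d.+1%:R]natr1.
have rn : (r ^+ 2) ^+ n != 0 by rewrite !expf_neq0.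
move: ((r ^+ 2) ^+ n) rn => rn rn0.
case: n n_gt0 => [//|[|m]] _.
  by rewrite !subnn expr0 expr1 /= !exprS; field; rewrite ?rn0 ?r0.
rewrite subn1 subn2 /= -[m.+2%:R]natr1 -[m.+1%:R]natr1 !exprS.
by field; rewrite ?rn0 ?r0.
Qed.

Lemma integrated_equation_qt : exists E, integrated_equation D k Z E.
Proof.
exists (fun f r => T0_of D k (@alpha_qt R D n c) f r - T1_qt D n c k f r
  + derive1 (T2_qt D n c k f) r).
exists (@alpha_qt R D n c), (T1_qt D n c k), (T2_qt D n c k).
by split => //; exact: N_expansion_qt.
Qed.

Lemma integrated_equation_value E f r : integrated_equation D k Z E -> regular_at f r ->
  E f r = - c * ((D%:R - (2 * n)%:R) * r ^ (D%:Z - (2 * n)%:Z - 1) * (k - f r) ^+ n).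
Proof.
move=> [alpha [T1 [T2 [EX EE]]]] reg; rewrite (EE f r reg).
have EQ := N_expansion_qt D_ge5 n_gt0 formQ k.
have U f' r' (reg' : regular_at f' r') := N_expansion_unique EX EQ reg'.
have -> : T0_of D k alpha f r = c * qt_potential D n k f r.
  rewrite -T0_of_alpha_qt //; apply: T0_of_unique => //; first exact: leq_trans D_ge5.
  by move=> f' r' reg'; case: (U f' r' reg').
have [_ -> _] := U f r reg.
(* T_2 enters through its derivative, so uniqueness is applied at all points near r. *)
rewrite (@near_eq_derive1_at _ (T2 f) (T2_qt D n c k f)) ?integrated_value //.
by apply: filterS (near_regular_at reg) => s regs; case: (U f s regs).
Qed.

End IntegratedEquation.

Theorem mainTheorem7 (R : realType) (D n : nat) (hD : (5 <= D)%N)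
    (hn : (1 <= n)%N) (k : R) (hk : horizon_curvature k) (Z : density R n)
    (hZ : quasi_topological D k Z) :
  (exists c : R, forall k' : R, horizon_curvature k' ->
     forall (f : R -> R) (x : 'rV[R]_D),
       in_chart k' x -> regular_at f (radial_coord x) ->
       on_shell k' Z f x =
       c / radial_coord x ^+ (D - 2) *
       derive1 (fun r => r ^+ (D - 1) *
          (((2 * n)%:R - D%:R) * psi k' f r ^+ n
           - (2 * n)%:R * psi k' f r ^+ (n - 1) * calB f r)) (radial_coord x))
  /\
  (exists c' : R, forall k' : R, horizon_curvature k' ->
     (exists E : (R -> R) -> R -> R, integrated_equation D k' Z E) /\
     (forall E : (R -> R) -> R -> R, integrated_equation D k' Z E ->
        forall (f : R -> R) (r : R), regular_at f r ->
        E f r = c' * ((D%:R - (2 * n)%:R)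
                      * r ^ (D%:Z - (2 * n)%:Z - 1) * (k' - f r) ^+ n)))
  /\
  (forall Z' : density R n, quasi_topological D k Z' ->
     (exists (f : R -> R) (x : 'rV[R]_D),
        [/\ in_chart k x, regular_at f (radial_coord x) & on_shell k Z f x <> 0]) ->
     exists lambda : R, forall k' : R, horizon_curvature k' ->
       forall (f : R -> R) (x : 'rV[R]_D),
         in_chart k' x -> regular_at f (radial_coord x) ->
         on_shell k' Z' f x = lambda * on_shell k' Z f x).
Proof.
(* The hypothesis for the single curvature k fixes Q, which does not involve k; [formZ] therefore
   applies to every k'. *)
have [c formZ] := onshell_pexp_form hD hn hk hZ.
split; [|split].
- by exists c => k' _ f x cx reg; exact: on_shell_qt.
- exists (- c) => k' hk'; split; first exact: integrated_equation_qt hD hn formZ.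
  by move=> E hE f r reg; exact: integrated_equation_value hD hn hk' formZ E f r hE reg.
- move=> Z' hZ' [f0 [x0 [cx0 reg0 nz]]].
  have [c' formZ'] := onshell_pexp_form hD hn hk hZ'.
  have c0 : c != 0.
    by apply: contra_notN nz => /eqP c0; rewrite (on_shell_qt hD hn formZ) // c0 !mul0r.
  exists (c' / c) => k' _ f x cx reg.
  by rewrite (on_shell_qt hD hn formZ) // (on_shell_qt hD hn formZ') // !mulrA divfK.
Qed.
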